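(* Fix the number of players $n\ge1$, action counts $d=(d_1,\ldots,d_n)$ with each $d_j\ge1$, and a player $i\in[n]$. There are an integer $m\ge1$, constants $A,M<\infty$, and $\eta_i>0$, uniform over all $n$-player games with action counts $d$ and loss tables valued in $[0,1]^n$, such that for every such game, every step size $0<\eta\le\eta_i$, and every $t\ge1$, there exist real scalars $c_{0,t},\ldots,c_{m-1,t}$ (possibly depending on the game, $\eta$, and $t$) for which the weighted pairwise loss-gap vectors $h_i^t$ of the Optimistic Hedge iterates with step size $\eta$ satisfy $$\Delta^m h_i^{t+m}=\sum_{k=0}^{m-1}c_{k,t}\,\eta^{m-k}\,\Delta^kh_i^{t+k},\qquad |c_{k,t}|\le A\quad(0\le k\le m-1),$$ $$\|\Delta^kh_i^{t+k}\|_2\le M\eta^k,\qquad 0\le k\le m.$$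
   Context: Notation: $[q]=\{1,\ldots,q\}$, $\Delta_q=\{x\in\mathbb R_{\ge0}^q:\sum_a x_a=1\}$ (probability simplex). For a sequence $y=(y^t)$, finite differences are $\Delta^0y^t=y^t$, $\Delta y^t=y^{t+1}-y^t$, $\Delta^{k+1}y^t=\Delta(\Delta^ky^t)$. Games: there are $n$ players; player $i$ has action set $A_i=[d_i]$ and mixed strategies $x_i\in\Delta_{d_i}$. A game is given by a loss table $\ell:\prod_{j=1}^nA_j\to[0,1]^n$. For a strategy profile $x$ with $x_{-i}=(x_j)_{j\ne i}$, the expected loss vector of player $i$ is $\ell_i(x_{-i})\in[0,1]^{d_i}$, $$[\ell_i(x_{-i})]_{a_i}=\sum_{a_{-i}\in\prod_{j\ne i}A_j}[\ell(a_i,a_{-i})]_i\prod_{j\ne i}x_{j,a_j}.$$ Optimistic Hedge with common constant step size $\eta>0$: set $\ell_i^0=0\in\mathbb R^{d_i}$ and $x_i^1=(1/d_i,\ldots,1/d_i)$ for every $i$. For $t\ge1$ let $\ell_i^t=\ell_i(x_{-i}^t)$, and for all players simultaneously $$x_{i,a}^{t+1}=\frac{x_{i,a}^t\exp\{-\eta(2\ell_{i,a}^t-\ell_{i,a}^{t-1})\}}{\sum_{b\in A_i}x_{i,b}^t\exp\{-\eta(2\ell_{i,b}^t-\ell_{i,b}^{t-1})\}},\qquad a\in A_i.$$ Weighted pairwise loss gaps: for $t\ge1$, $h_i^t\in\mathbb R^{\binom{d_i}{2}}$ is indexed by pairs $a<b$ in $A_i$, with $$[h_i^t]_{ab}=\sqrt{x_{i,a}^t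 x_{i,b}^t}\,\bigl(\ell_{i,a}^{t-1}-\ell_{i,b}^{t-1}\bigr).$$ *)

(* Defs.v *)
From HB Require Import structures.
From mathcomp Require Import all_boot all_order all_algebra.
From mathcomp Require Import reals sequences exp.
Set Implicit Arguments.
Unset Strict Implicit.
Unset Printing Implicit Defensive.
Import Order.TTheory GRing.Theory Num.Theory.
Local Open Scope ring_scope.

Section FiniteDifferences.
Variable V : zmodType.

Definition fdiff (y : nat -> V) : nat -> V := fun t => y t.+1 - y t.

Definition fdiffn (k : nat) (y : nat -> V) : nat -> V := iter k fdiff y.

End FiniteDifferences.

Section Games.
Variables (R : realType) (n : nat) (d : 'I_n -> nat).

Definition action_profile := {dffun forall j : 'I_n, 'I_(d j)}.

(* The value at j is a vector indexed by the actions of player j: its mixed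
   strategy, or its loss vector. *)
Definition vec_profile := forall j : 'I_n, 'I_(d j) -> R.

(* ell a i is the loss of player i under the action profile a. *)
Definition loss_table := action_profile -> 'I_n -> R.

Definition unit_valued (ell : loss_table) : Prop :=
  forall a i, 0 <= ell a i <= 1.

(* The sum over a_{-i} is taken over the full profiles a whose i-th
   coordinate is the prescribed action ai. *)
Definition expected_loss (ell : loss_table) (x : vec_profile) : vec_profile :=
  fun i ai =>
    \sum_(a : action_profile | a i == ai)
      ell a i * \prod_(j < n | j != i) x j (a j).

Definition uniform_profile : vec_profile := fun i _ => (d i)%:R^-1.

Definition zero_profile : vec_profile := fun _ _ => 0.

Definition oh_weight (eta : R) (x l lprev : vec_profile) : vec_profile :=
  fun i a => x i a * expR (- (eta * (2 * l i a - lprev i a))).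

Definition oh_update (eta : R) (x l lprev : vec_profile) : vec_profile :=
  fun i a => oh_weight eta x l lprev a
             / \sum_(b < d i) oh_weight eta x l lprev b.

Section OptimisticHedge.
Variables (ell : loss_table) (eta : R).

(* oh_state t is the pair (x^{t+1}, l^t). *)
Fixpoint oh_state (t : nat) : vec_profile * vec_profile :=
  if t is t'.+1 then
    let: (x, lprev) := oh_state t' in
    let l := expected_loss ell x in
    (oh_update eta x l lprev, l)
  else (uniform_profile, zero_profile).

(* Iterates start at t = 1; oh_strategy 0 is a junk value. *)
Definition oh_strategy (t : nat) : vec_profile := (oh_state t.-1).1.

Definition oh_loss (t : nat) : vec_profile := (oh_state t).2.

Lemma oh_strategy1 : oh_strategy 1 = uniform_profile.
Proof. by []. Qed.

Lemma oh_loss0 : oh_loss 0 = zero_profile.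
Proof. by []. Qed.

Lemma oh_lossE (t : nat) : (0 < t)%N ->
  oh_loss t = expected_loss ell (oh_strategy t).
Proof.
by case: t => // t _; rewrite /oh_loss /oh_strategy /=; case: (oh_state t).
Qed.

Lemma oh_strategyS (t : nat) : (0 < t)%N ->
  oh_strategy t.+1 = oh_update eta (oh_strategy t) (oh_loss t) (oh_loss t.-1).
Proof.
by case: t => // t _; rewrite /oh_loss /oh_strategy /=; case: (oh_state t).
Qed.

End OptimisticHedge.

End Games.

Definition action_pair (q : nat) := {p : 'I_q * 'I_q | (p.1 < p.2)%N}.

Definition loss_gap (R : realType) (n : nat) (d : 'I_n -> nat)
    (ell : loss_table R d) (eta : R) (i : 'I_n) (t : nat) :
    {ffun action_pair (d i) -> R^o} :=
  [ffun p : action_pair (d i) =>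
     let: (a, b) := val p in
     Num.sqrt (oh_strategy ell eta t a * oh_strategy ell eta t b)
     * (oh_loss ell eta t.-1 a - oh_loss ell eta t.-1 b)].

Definition norm2 (R : realType) (I : finType) (v : {ffun I -> R^o}) : R :=
  Num.sqrt (\sum_(p : I) v p ^+ 2).

(* Main.v *)
(* After a normalisation by sqrt(x_a^t x_b^t), constant along a window starting at
   time t, the gap at time t + s is an analytic function of eta whose Taylor
   coefficients are polynomials in finitely many bounded variables: the loss
   table, x^t and l^{t-1}.  Its k-th difference at s = k is divisible by eta^k as a
   power series, say with quotient G_k.  The lowest coefficients in eta of the
   combinations of G_0, G_1, ... generate an ascending chain of modules over a
   polynomial ring, which is stationary; hence for some m the series G_m can be
   divided by G_0, ..., G_{m-1}.  To make the quotients converge, each such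
   module is given generators with norm-bounded division, for a
   weighted l^1 norm with radii large enough for leading terms to dominate; the
   quotients then have geometrically bounded Taylor coefficients, so that the
   combination has bounded scalars for all small eta, uniformly in the game. *)

Require Import Defs.
From HB Require Import structures.
From mathcomp Require Import all_boot all_order all_algebra.
From mathcomp Require Import all_classical reals topology normedtype derive.
From mathcomp Require Import sequences exp.
From mathcomp Require Import ring lra zify.
Set Implicit Arguments.
Unset Strict Implicit.
Unset Printing Implicit Defensive.
Import Order.TTheory GRing.Theory Num.Theory.
Import numFieldNormedType.Exports.
Local Open Scope ring_scope.

(** * Modules with norm-bounded division *)

(** The differences are taken at time [t + k] because the loss at the start of a window is a
    variable independent of the strategy there (at [t = 1] it is the conventional zero). Its jump to
    the next loss need not be small in [eta], and each further order of smoothness costs one more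
    step away from the start.

    Finite generation alone would not suffice. Division in the step size gains one power of [eta]
    per step and never ends, so the constants of successive steps multiply. A division bound that is
    linear, with one constant for the whole module, keeps this growth geometric, and small [eta]
    then beats it. Stationarity leaves finitely many modules, so one norm can serve them all. The
    norm must dominate evaluation at every game; hence variables scaled into [[-1, 1]] and radii at
    least 1.

    The quotients are never summed: after [n] steps the scalars lie in a fixed box with an error
    tending to 0, and compactness gives an exact relation. The square roots depend on the coordinate
    but not on the order of the difference, so they multiply the relation coordinatewise and leave
    its scalars alone. *)

Section BoundedDivision.
Variable R : realType.

Definition submodule (P : comNzRingType) (D : nat) (L : 'rV[P]_D -> Prop) :=
  [/\ L 0, forall u v, L u -> L v -> L (u + v) & forall p u, L u -> L (p *: u)].

Definition row_norm (P : comNzRingType) (nu : P -> R) (D : nat) (v : 'rV[P]_D) : R :=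
  \sum_c nu (v 0 c).

Definition admissible (P : comNzRingType) (C : {rmorphism R -> P}) (T : Type) (ev : T -> P -> R)
    (nu : P -> R) :=
  [/\ forall p, 0 <= nu p,
      forall p q, nu (p + q) <= nu p + nu q,
      forall p q, nu (p * q) <= nu p * nu q,
      forall c, nu (C c) <= `|c|
    & forall s p, `|ev s p| <= nu p].

(** The constant [K] is the same for all elements of [L]; infinitely many divisions can then be
    chained with geometric control. *)
Definition divides_boundedly (P : comNzRingType) (nu : P -> R) (D : nat)
    (L : 'rV[P]_D -> Prop) :=
  exists (I : finType) (g : I -> 'rV[P]_D) (K : R),
    [/\ 0 <= K, forall i, L (g i) &
      forall a, L a -> exists q : I -> P,
        a = \sum_i q i *: g i /\ \sum_i nu (q i) <= K * row_norm nu a].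

(** One norm for a finite family: the passage to polynomials needs it for leading coefficients in
    several degrees at once, and the division in the step size for several orders at once. *)
Definition bounded_noetherian (P : comNzRingType) (C : {rmorphism R -> P}) (T : Type)
    (ev : T -> P -> R) :=
  forall (D : nat) (J : finType) (L : J -> 'rV[P]_D -> Prop),
    (forall j, submodule (L j)) ->
    exists nu, admissible C ev nu /\ forall j, divides_boundedly nu (L j).

Lemma submodule_sum (P : comNzRingType) D (L : 'rV[P]_D -> Prop) (I : finType)
    (q : I -> P) (g : I -> 'rV[P]_D) :
  submodule L -> (forall i, L (g i)) -> L (\sum_i q i *: g i).
Proof.
move=> [L0 LD LZ] Lg; elim/big_ind: _ => // i _; exact: LZ.
Qed.

Lemma submodule_sub (P : comNzRingType) D (L : 'rV[P]_D -> Prop) u v :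
  submodule L -> L u -> L v -> L (u - v).
Proof. by move=> [L0 LD LZ] Lu Lv; apply: LD => //; rewrite -scaleN1r; apply: LZ. Qed.

(** The union of the chain is a submodule, hence finitely generated, and its generators all occur at
    one finite stage. *)
Lemma chain_stabilizes (P : comNzRingType) (C : {rmorphism R -> P}) (T : Type) (ev : T -> P -> R)
    D (L : nat -> 'rV[P]_D -> Prop) :
  bounded_noetherian C ev ->
  (forall k, submodule (L k)) -> (forall k u, L k u -> L k.+1 u) ->
  exists k0, forall k u, (k0 <= k)%N -> L k u -> L k0 u.
Proof.
move=> bn sL incL.
have mono k l u : (k <= l)%N -> L k u -> L l u.
  move=> /subnK <-; elim: (l - k)%N => // e IH /IH; rewrite addSn; exact: incL.
pose U := fun u => exists k, L k u.
have sU : submodule U.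
  split=> [|u v [k Lu] [l Lv]|p u [k Lu]].
  - by exists 0%N; case: (sL 0%N).
  - exists (maxn k l); case: (sL (maxn k l)) => _ LD _.
    by apply: LD; [apply: mono Lu; rewrite leq_maxl | apply: mono Lv; rewrite leq_maxr].
  - by exists k; case: (sL k) => _ _; apply.
have [nu [_ /(_ tt)[I [g [K [_ gU gen]]]]]] := bn D unit (fun _ => U) (fun _ => sU).
have [f Hf] := choice gU.
exists (\max_i f i) => k u _ Lu.
have [q [-> _]] := gen u (ex_intro _ k Lu).
apply: submodule_sum => // i; apply: mono (Hf i).
exact: leq_bigmax.
Qed.

Lemma mem_submodule_sub (D m : nat) (L : 'rV[R]_D -> Prop) (A : 'M[R]_(m, D)) v :
  submodule L -> (forall i, L (row i A)) -> (v <= A)%MS -> L v.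
Proof.
move=> sL LA /submxP [w ->]; rewrite mulmx_sum_row.
exact: submodule_sum.
Qed.

(** Over the field [R], a matrix of maximal rank with rows in [L j] spans it, since a further row
    would raise the rank. Coordinates come from the pseudo-inverse, and its entries give the
    constant. *)
Lemma bounded_noetherian_base (T : Type) :
  bounded_noetherian (P := R) idfun (fun (_ : T) => idfun).
Proof.
move=> D J L sL; exists (fun x => `|x|); split.
  split=> //; [exact: ler_normD | by move=> p q; rewrite normrM].
move=> j.
pose Q := fun r => `[< exists A : 'M[R]_D, (forall i, L j (row i A)) /\ \rank A = r >].
have exQ : exists r, Q r.
  exists 0%N; apply/asboolP; exists 0; rewrite mxrank0; split=> // i.
  by rewrite row0; case: (sL j).
have bQ r : Q r -> (r <= D)%N.
  by move=> /asboolP[A [_ <-]]; exact: rank_leq_row.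
case: (ex_maxnP exQ bQ) => r /asboolP[A [LA rA]] maxr.
have LsubA a : L j a -> (a <= A)%MS.
  move=> La.
  have LB v : (v <= A + a)%MS -> L j v.
    move=> /sub_addsmxP[[u w] ->].
    case: (sL j) => _ LD _; apply: LD.
      by apply: mem_submodule_sub (sL j) LA _; rewrite submxMl.
    apply: (mem_submodule_sub (A := a)) (sL j) _ _; last by rewrite submxMl.
    by move=> i; rewrite [i]ord1 (_ : row 0 a = a) //; apply/rowP => c; rewrite !mxE.
  have : Q (\rank (A + a)%MS).
    by apply/asboolP; exists (A + a)%MS; split=> // i; apply: LB; rewrite row_sub.
  move=> /maxr; rewrite -rA => le.
  have := mxrank_leqif_sup (addsmxSl A a) => -[_].
  rewrite eqn_leq le mxrankS ?addsmxSl //= => /esym.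
  by rewrite addsmx_sub => /andP[].
pose B := pinvmx A.
exists 'I_D, (fun i => row i A), (\sum_c \sum_i `|B c i|); split=> //.
  by apply: sumr_ge0 => c _; apply: sumr_ge0.
move=> a La; exists (fun i => (a *m B) 0 i); split.
  by rewrite -mulmx_sum_row mulmxKpV // LsubA.
apply: (@le_trans _ _ (\sum_i \sum_c `|a 0 c| * `|B c i|)).
  apply: ler_sum => i _; rewrite mxE.
  by apply: le_trans (ler_norm_sum _ _ _) _; apply: ler_sum => c _; rewrite normrM.
rewrite exchange_big mulr_suml /=; apply: ler_sum => c _.
rewrite -mulr_sumr mulrC ler_wpM2l ?sumr_ge0 //.
rewrite /row_norm (bigD1 c) //= lerDl; exact: sumr_ge0.
Qed.

End BoundedDivision.

Section Admissible.
Variables (R : realType) (P : comNzRingType) (C : {rmorphism R -> P}) (T : Type)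
  (ev : T -> P -> R) (nu : P -> R).
Hypothesis adm : admissible C ev nu.

Lemma nu_ge0 p : 0 <= nu p. Proof. by case: adm. Qed.
Lemma nuD p q : nu (p + q) <= nu p + nu q. Proof. by case: adm. Qed.
Lemma nuM p q : nu (p * q) <= nu p * nu q. Proof. by case: adm. Qed.
Lemma nuC c : nu (C c) <= `|c|. Proof. by case: adm. Qed.
Lemma nu_ev s p : `|ev s p| <= nu p. Proof. by case: adm. Qed.
Lemma nu0 : nu 0 = 0.
Proof. by apply/le_anti; have := nuC 0; rewrite rmorph0 normr0 nu_ge0 andbT. Qed.
Lemma nu1 : nu 1 <= 1.
Proof. by have := nuC 1; rewrite rmorph1 normr1. Qed.
Lemma nuCM c p : nu (C c * p) <= `|c| * nu p.
Proof. by apply: le_trans (nuM _ _) _; rewrite ler_wpM2r ?nu_ge0 ?nuC. Qed.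
Lemma nuN p : nu (- p) <= nu p.
Proof.
rewrite -mulN1r -(rmorph1 C) -rmorphN.
by apply: le_trans (nuCM _ _) _; rewrite normrN1 mul1r.
Qed.
Lemma nuB p q : nu (p - q) <= nu p + nu q.
Proof. by apply: le_trans (nuD _ _) _; rewrite lerD2l nuN. Qed.
Lemma nu_sum (I : Type) (r : seq I) (S : pred I) (F : I -> P) :
  nu (\sum_(i <- r | S i) F i) <= \sum_(i <- r | S i) nu (F i).
Proof.
elim/big_ind2: _ => [|x u y v le1 le2|//]; first by rewrite nu0.
by apply: le_trans (nuD _ _) _; rewrite lerD.
Qed.

Lemma row_norm_ge0 D (v : 'rV[P]_D) : 0 <= row_norm nu v.
Proof. by apply: sumr_ge0 => c _; exact: nu_ge0. Qed.

End Admissible.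

(** * Weighted l^1 norms on univariate polynomials *)

Section PolynomialNorm.
Variables (R : realType) (P : comNzRingType) (C : {rmorphism R -> P}) (T : Type)
  (ev : T -> P -> R) (nu : P -> R).
Hypothesis adm : admissible C ev nu.
Variable r : R.
Hypothesis r1 : 1 <= r.
Let r0 : 0 <= r. Proof. exact: le_trans r1. Qed.

(** The cutoff is independent of the size, so that the part of a polynomial below its leading term
    can be measured separately. *)
Definition trunc_norm N (p : {poly P}) : R := \sum_(j < N) nu p`_j * r ^+ j.
Definition poly_norm (p : {poly P}) := trunc_norm (size p) p.

Lemma trunc_norm_ge0 N p : 0 <= trunc_norm N p.
Proof. by apply: sumr_ge0 => j _; rewrite mulr_ge0 ?(nu_ge0 adm) ?exprn_ge0. Qed.

Lemma trunc_normE N (p : {poly P}) : (size p <= N)%N -> trunc_norm N p = poly_norm p.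
Proof.
move=> /subnKC <-; rewrite /trunc_norm big_split_ord /= [X in _ + X]big1 ?addr0 //.
by move=> i _; rewrite nth_default ?leq_addr // (nu0 adm) mul0r.
Qed.

Lemma trunc_normD N p q : trunc_norm N (p + q) <= trunc_norm N p + trunc_norm N q.
Proof.
rewrite -big_split /=; apply: ler_sum => j _.
by rewrite coefD -mulrDl ler_wpM2r ?exprn_ge0 // (nuD adm).
Qed.

Lemma trunc_normN N p : trunc_norm N (- p) <= trunc_norm N p.
Proof.
apply: ler_sum => j _.
by rewrite coefN ler_wpM2r ?exprn_ge0 // (nuN adm).
Qed.

Lemma trunc_norm_shift c e k p :
  trunc_norm (e + k) (c%:P * 'X^e * p) <= nu c * r ^+ e * trunc_norm k p.
Proof.
rewrite /trunc_norm big_split_ord /= big1 ?add0r => [|i _].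
  rewrite mulr_sumr; apply: ler_sum => i _.
  rewrite -mulrA coefCM coefXnM ltnNge leq_addr /= addKn exprD.
  rewrite mulrACA ler_wpM2r ?mulr_ge0 ?exprn_ge0 //; exact: nuM adm _ _.
by rewrite -mulrA coefCM coefXnM ltn_ord mulr0 (nu0 adm) mul0r.
Qed.

Lemma poly_norm_ge0 p : 0 <= poly_norm p.
Proof. exact: trunc_norm_ge0. Qed.

Lemma poly_normD p q : poly_norm (p + q) <= poly_norm p + poly_norm q.
Proof.
have sz := size_polyD p q.
rewrite -(trunc_normE sz) -(trunc_normE (leq_maxl _ (size q))).
by rewrite -[in X in _ <= _ + X](trunc_normE (leq_maxr (size p) _)) trunc_normD.
Qed.

Lemma poly_norm0 : poly_norm 0 = 0.
Proof. by rewrite /poly_norm /trunc_norm size_poly0 big_ord0. Qed.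

Lemma poly_norm_shift c e p :
  poly_norm (c%:P * 'X^e * p) <= nu c * r ^+ e * poly_norm p.
Proof.
rewrite -(trunc_normE (N := (e + size p)%N)); first exact: trunc_norm_shift.
rewrite mulrAC -mulrA mul_polyC; apply: leq_trans (size_scale_leq _ _) _.
apply: leq_trans (size_polyMleq _ _) _.
by rewrite size_polyXn addnS /= addnC.
Qed.

Lemma poly_norm_monomial c e : poly_norm (c%:P * 'X^e) <= nu c * r ^+ e.
Proof.
rewrite -[X in poly_norm X]mulr1; apply: le_trans (poly_norm_shift _ _ _) _.
rewrite ler_piMr ?mulr_ge0 ?exprn_ge0 ?(nu_ge0 adm) //.
rewrite /poly_norm /trunc_norm size_poly1 big_ord1 coef1 expr0 mulr1.
exact: nu1 adm.
Qed.

Lemma poly_normM p q : poly_norm (p * q) <= poly_norm p * poly_norm q.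
Proof.
rewrite {1}(_ : p = \sum_(i < size p) (p`_i)%:P * 'X^i); last first.
  by rewrite -[LHS]coefK poly_def; apply: eq_bigr => i _; rewrite mul_polyC.
rewrite mulr_suml {2}/poly_norm /trunc_norm mulr_suml.
elim/big_ind2: _ => [|x u y v le1 le2|i _]; first by rewrite poly_norm0.
  by apply: le_trans (poly_normD _ _) _; rewrite lerD.
exact: poly_norm_shift.
Qed.

(** The radius [r >= 1] makes each weight [r ^+ i] at least [x ^+ i] in absolute value when
    [|x| <= 1]. *)
Lemma poly_admissible T' (ev' : T' -> {poly P} -> R) :
  (forall s', exists s x, `|x| <= 1 /\
     forall p, ev' s' p = \sum_(i < size p) ev s p`_i * x ^+ i) ->
  admissible (polyC \o C) ev' poly_norm.
Proof.
move=> Hev; split.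
- exact: poly_norm_ge0.
- exact: poly_normD.
- exact: poly_normM.
- move=> c /=; rewrite -(trunc_normE (N := 1)) ?size_polyC ?leq_b1 //.
  by rewrite /trunc_norm big_ord1 coefC /= mulr1 (nuC adm).
- move=> s' p; have [s [x [x1 ->]]] := Hev s'.
  apply: le_trans (ler_norm_sum _ _ _) _; apply: ler_sum => i _.
  rewrite normrM ler_pM ?normr_ge0 ?(nu_ev adm) // normrX.
  apply: lerXn2r; rewrite ?nnegrE //; exact: le_trans x1 r1.
Qed.

End PolynomialNorm.

(** [untag 0 q] extends by zero a family living on one fibre. Generators of all degrees can thus
    share one index type while a single division uses those of one degree. *)
Lemma sum_untag (V W : zmodType) (I : finType) (T_ : I -> finType) k
    (q : T_ k -> V) (F : {i : I & T_ i} -> V -> W) :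
  (forall x, F x 0 = 0) ->
  \sum_x F x (untag 0 q x) = \sum_j F (Tagged T_ j) (q j).
Proof.
move=> F0.
transitivity (\sum_(x : {i : I & T_ i})
  F (Tagged T_ (tagged x)) (untag 0 q (Tagged T_ (tagged x)))).
  by apply: eq_bigr => -[].
have /= <- := sig_big_dep xpredT (fun=> xpredT)
  (fun i (j : T_ i) => F (Tagged T_ j) (untag 0 q (Tagged T_ j))).
rewrite (bigD1 k) //= [X in _ + X]big1 ?addr0 => [|i ik].
  by apply: eq_bigr => j _; rewrite (untagE 0 q (erefl : tag (Tagged T_ j) = k)).
by rewrite big1 // => j _; rewrite untag_dflt.
Qed.

(** * Hilbert's basis theorem with norm bounds *)

Section PolynomialDivision.
Variables (R : realType) (P : comNzRingType) (C : {rmorphism R -> P}) (T : Type)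
  (ev : T -> P -> R) (D : nat).
Implicit Types (L : 'rV[{poly P}]_D -> Prop) (w : 'rV[{poly P}]_D).

Definition lead_row k w : 'rV[P]_D := \row_c (w 0 c)`_k.

(** The leading-coefficient modules of Hilbert's argument; bounding the degree by [k], without
    fixing it, keeps them closed under addition. *)
Definition lead_module L k (v : 'rV[P]_D) :=
  exists w, [/\ L w, forall c, (size (w 0%R c) <= k.+1)%N & v = lead_row k w].

Lemma lead_module_submodule L k : submodule L -> submodule (lead_module L k).
Proof.
move=> [L0 LD LZ]; split.
- exists 0; split=> // [c|]; first by rewrite mxE size_poly0.
  by apply/rowP => c; rewrite !mxE coef0.
- move=> u v [w [Lw sw ->]] [w' [Lw' sw' ->]]; exists (w + w'); split.
  + exact: LD.
  + by move=> c; rewrite mxE; apply: leq_trans (size_polyD _ _) _; rewrite geq_max sw sw'.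
  + by apply/rowP => c; rewrite !mxE coefD.
- move=> p u [w [Lw sw ->]]; exists (p%:P *: w); split.
  + exact: LZ.
  + move=> c; rewrite mxE mul_polyC; exact: leq_trans (size_scale_leq _ _) (sw c).
  + by apply/rowP => c; rewrite !mxE coefCM.
Qed.

Lemma lead_moduleS L k v : submodule L -> lead_module L k v -> lead_module L k.+1 v.
Proof.
move=> [_ _ LZ] [w [Lw sw ->]]; exists ('X *: w); split.
- exact: LZ.
- move=> c; rewrite mxE; apply: leq_trans (size_polyMleq _ _) _.
  by rewrite size_polyX addSn /= add1n ltnS.
- by apply/rowP => c; rewrite !mxE coefXM.
Qed.

Variable nu : P -> R.
Hypothesis adm : admissible C ev nu.

Section Reduction.
Variables (L : 'rV[{poly P}]_D -> Prop) (sL : submodule L) (k0 : nat).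
Hypothesis stable : forall k v, (k0 <= k)%N -> lead_module L k v -> lead_module L k0 v.
Variables (G : finType) (w : G -> 'rV[{poly P}]_D) (K B r : R).
Hypotheses (K0 : 0 <= K) (B0 : 0 <= B) (r1 : 1 <= r) (rKB : 2 * K * B <= r).
Hypothesis divL : forall k, (k <= k0)%N -> forall v, lead_module L k v ->
  exists q : G -> P,
    [/\ v = \sum_i q i *: lead_row k (w i), \sum_i nu (q i) <= K * row_norm nu v &
     forall i, q i != 0 -> [/\ L (w i), forall c, (size (w i 0%R c) <= k.+1)%N &
       r * (\sum_c trunc_norm nu r k (w i 0 c)) <= B * r ^+ k]].

Let r0 : 0 <= r. Proof. exact: le_trans r1. Qed.
Let rp : 0 < r. Proof. exact: lt_le_trans r1. Qed.

Definition trunc_row_norm N (a : 'rV[{poly P}]_D) :=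
  \sum_c trunc_norm nu r N (a 0 c).

Lemma trunc_row_normD N a b :
  trunc_row_norm N (a + b) <= trunc_row_norm N a + trunc_row_norm N b.
Proof.
rewrite -big_split; apply: ler_sum => c _; rewrite mxE /=; exact: (trunc_normD adm r1).
Qed.

(** A potential argument. Cancelling the top row, of norm [V], in degree [N] costs at most
    [K * V * r ^+ N] in quotients and adds at most half of [V * r ^+ N] to the lower part. The top
    row contributes [V * r ^+ N] to the norm of [a], and [2 * K] times that pays for both. *)
Lemma reduction N a : L a -> (forall c, size (a 0%R c) <= N)%N ->
  exists q : G -> {poly P}, a = \sum_i q i *: w i /\
    \sum_i poly_norm nu r (q i) <= 2 * K * trunc_row_norm N a.
Proof.
elim: N a => [|N IH] a La sa.
  exists (fun=> 0); split.
    rewrite big1 => [|i _]; last by rewrite scale0r.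
    by apply/rowP => c; rewrite mxE; apply/eqP; rewrite -size_poly_leq0.
  rewrite big1 => [|i _]; last by rewrite poly_norm0.
  by rewrite /trunc_row_norm big1 ?mulr0 // => c _; rewrite /trunc_norm big_ord0.
pose v := lead_row N a.
have Lv : lead_module L N v by exists a.
(* Above degree [k0] no new leading rows appear, so generators of degree [k0], multiplied by ['X^e],
   are enough. *)
pose k := minn N k0.
have kk0 : (k <= k0)%N by rewrite geq_minr.
have kN : (k <= N)%N by rewrite geq_minl.
have Lkv : lead_module L k v.
  rewrite /k; case: (leqP N k0) => [//|/ltnW le]; exact: stable Lv.
have [q [vE qle wq]] := divL kk0 Lkv.
pose e := (N - k)%N.
have eN : (e + k = N)%N by rewrite subnK.
pose s := \sum_i ((q i)%:P * 'X^e) *: w i.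
have q0E i : q i = 0 -> ((q i)%:P * 'X^e) *: w i = 0.
  by move=> ->; rewrite polyC0 mul0r scale0r.
have Ls : L s.
  case: (sL) => L0 LD LZ; rewrite /s; elim/big_ind: _ => // i _.
  case: (eqVneq (q i) 0) => [/q0E -> //|/wq[Lw _ _]]; exact: LZ.
have coefs c j : (s 0 c)`_j = \sum_i q i * (if (j < e)%N then 0 else (w i 0 c)`_(j - e)).
  rewrite summxE coef_sum; apply: eq_bigr => i _.
  by rewrite mxE -mulrA coefCM coefXnM.
have sa' c : (size ((a - s)%R 0%R c) <= N)%N.
  apply/leq_sizeP => j Nj; rewrite mxE [(- s) 0 c]mxE coefB coefs.
  move: Nj; rewrite leq_eqVlt => /predU1P[<-|Nj].
    have := congr1 (fun x : 'rV_D => x 0 c) vE; rewrite summxE mxE => ->.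
    rewrite ltnNge leq_subr /= subKn // -sumrB big1 // => i _.
    by rewrite !mxE subrr.
  rewrite nth_default ?sub0r; last exact: leq_trans (sa c) _.
  rewrite big1 ?oppr0 // => i _; case: ifP => _; first by rewrite mulr0.
  case: (eqVneq (q i) 0) => [->|/wq[_ sw _]]; first by rewrite mul0r.
  by rewrite nth_default ?mulr0 //; apply: leq_trans (sw c) _; lia.
have [q' [aE q'le]] := IH _ (submodule_sub sL La Ls) sa'.
exists (fun i => q' i + (q i)%:P * 'X^e); split.
  under eq_bigr do rewrite scalerDl.
  by rewrite big_split /= -aE /s subrK.
set V := row_norm nu v.
have V0 : 0 <= V := row_norm_ge0 adm v.
have split_norm : trunc_row_norm N.+1 a = trunc_row_norm N a + V * r ^+ N.
  rewrite /trunc_row_norm /V /row_norm mulr_suml -big_split; apply: eq_bigr => c _.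
  by rewrite /trunc_norm big_ord_recr mxE.
(* Below degree [N] only the lower parts of the generators contribute, and their bound by [B] has a
   factor [r] to spare. *)
have snorm : r * trunc_row_norm N (- s) <= K * V * B * r ^+ N.
  apply: (@le_trans _ _ (r * \sum_i \sum_c trunc_norm nu r N
     ((((q i)%:P * 'X^e) *: w i) 0 c))).
    rewrite ler_wpM2l // exchange_big; apply: ler_sum => c _ /=.
    rewrite mxE; apply: le_trans (trunc_normN adm r1 _ _) _.
    rewrite /s summxE; elim/big_ind2: _ => [|x u y z le1 le2|//].
      by rewrite /trunc_norm big1 // => j _; rewrite coef0 (nu0 adm) mul0r.
    by apply: le_trans (@trunc_normD _ _ _ _ _ _ adm _ r1 _ _ _) _; rewrite lerD.
  apply: (@le_trans _ _ (\sum_i nu (q i) * (B * r ^+ N))); last first.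
    rewrite -mulr_suml mulrA -mulrA -[K * V * B * _]mulrA; apply: ler_wpM2r => //.
    by rewrite mulr_ge0 ?exprn_ge0.
  rewrite mulr_sumr; apply: ler_sum => i _.
  case: (eqVneq (q i) 0) => [qi0|/wq[_ sw wB]].
    rewrite (q0E _ qi0) qi0 (nu0 adm) mul0r big1 ?mulr0 // => c _.
    by rewrite mxE /trunc_norm big1 // => j _; rewrite coef0 (nu0 adm) mul0r.
  apply: (@le_trans _ _ (nu (q i) * r ^+ e *
     (r * \sum_c trunc_norm nu r k (w i 0 c)))).
    rewrite mulrCA ler_wpM2l // mulr_sumr; apply: ler_sum => c _.
    rewrite mxE -eN; exact: (trunc_norm_shift adm r1).
  rewrite -[in leRHS]eN exprD [B * _]mulrCA -!mulrA.
  by rewrite ler_wpM2l ?(nu_ge0 adm) // ler_wpM2l ?exprn_ge0.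
have half : 2 * trunc_row_norm N (- s) <= V * r ^+ N.
  rewrite -(ler_pM2l rp).
  apply: (@le_trans _ _ (2 * K * B * (V * r ^+ N))); first by rewrite mulrCA; lra.
  by rewrite ler_wpM2r ?mulr_ge0 ?exprn_ge0.
have qsum : \sum_i poly_norm nu r ((q i)%:P * 'X^e) <= K * (V * r ^+ N).
  apply: (@le_trans _ _ (\sum_i nu (q i) * r ^+ N)).
    apply: ler_sum => i _; apply: le_trans (poly_norm_monomial adm r1 _ _) _.
    by rewrite ler_wpM2l ?(nu_ge0 adm) // ler_weXn2l // leq_subr.
  by rewrite -mulr_suml mulrA ler_wpM2r ?exprn_ge0.
have := trunc_row_normD N a (- s) => tri.
apply: (@le_trans _ _ (\sum_i (poly_norm nu r (q' i)
    + poly_norm nu r ((q i)%:P * 'X^e)))).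
  by apply: ler_sum => i _; exact: (poly_normD adm r1).
rewrite big_split /=.
apply: le_trans (lerD q'le qsum) _; rewrite split_norm.
have KK : 2 * K * trunc_row_norm N (a - s)
   <= K * (2 * trunc_row_norm N a + V * r ^+ N).
  rewrite [2 * K]mulrC -mulrA ler_wpM2l //; lra.
by apply: le_trans (lerD KK (lexx _)) _; lra.
Qed.

End Reduction.

(** Every radius past a threshold works, so that finitely many modules can later share one. *)
Lemma poly_divides_boundedly (L : 'rV[{poly P}]_D -> Prop) (k0 : nat) :
  submodule L ->
  (forall k v, (k0 <= k)%N -> lead_module L k v -> lead_module L k0 v) ->
  (forall k, (k <= k0)%N -> divides_boundedly nu (lead_module L k)) ->
  exists rho, forall r, 1 <= r -> rho <= r -> divides_boundedly (poly_norm nu r) L.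
Proof.
move=> sL stable divk.
have /choice[Y HY] : forall k : 'I_k0.+1,
    exists y : {Gk : finType & ((Gk -> 'rV[{poly P}]_D) * R)%type},
      let: existT Gk (w, K) := y in
      [/\ 0 <= K, forall i, L (w i) /\ forall c, (size (w i 0%R c) <= k.+1)%N &
        forall v, lead_module L k v -> exists q : Gk -> P,
          v = \sum_i q i *: lead_row k (w i) /\ \sum_i nu (q i) <= K * row_norm nu v].
  move=> k; have [|Gk [g [K [K0 Lg gen]]]] := divk k; first by rewrite -ltnS.
  have [w Hw] := choice Lg.
  exists (existT _ Gk (w, K)); split=> // [i|v /gen[q [-> qle]]]; first by case: (Hw i).
  exists q; split=> //; apply: eq_bigr => i _; congr (_ *: _); by case: (Hw i).
pose Gk k := projT1 (Y k).
pose w k : Gk k -> _ := (projT2 (Y k)).1.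
pose K k := (projT2 (Y k)).2.
have HK k : 0 <= K k by move: (HY k); rewrite /K; case: (Y k) => ? [? ?] [].
have Hw k i : L (w k i) /\ forall c, (size (w k i 0%R c) <= k.+1)%N.
  by move: i (HY k); rewrite /Gk /w; case: (Y k) => J [w' K'] /= i [].
have Hq (k : 'I_k0.+1) v : lead_module L k v -> exists q : Gk k -> P,
    v = \sum_i q i *: lead_row k (w k i) /\ \sum_i nu (q i) <= K k * row_norm nu v.
  by move: (HY k); rewrite /Gk /w /K; case: (Y k) => J [w' K'] /= [_ _]; exact.
pose G := {k : 'I_k0.+1 & Gk k} : finType.
pose W (x : G) := w (tag x) (tagged x).
(* All coefficients that can lie below the top degree of some generator. A term of degree [j < k]
   weighs [r ^+ j], at most [r ^+ k / r], which is the gain needed in [reduction]. *)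
pose B := \sum_x \sum_c \sum_(j < k0) nu (W x 0 c)`_j.
exists (2 * (\sum_k K k) * B) => r r1 rle.
have r0 : 0 <= r by exact: le_trans r1.
have K0 : 0 <= \sum_k K k by exact: sumr_ge0.
have B0 : 0 <= B.
  by do 3![apply: sumr_ge0 => ? _]; exact: nu_ge0 adm _.
exists G, W, (2 * (\sum_k K k)); split; first by rewrite mulr_ge0.
  by move=> x; case: (Hw (tag x) (tagged x)).
move=> a La.
have divW k : (k <= k0)%N -> forall v, lead_module L k v -> exists q : G -> P,
    [/\ v = \sum_i q i *: lead_row k (W i),
        \sum_i nu (q i) <= (\sum_k K k) * row_norm nu v &
      forall i, q i != 0 -> [/\ L (W i), forall c, (size (W i 0%R c) <= k.+1)%N &
        r * (\sum_c trunc_norm nu r k (W i 0 c)) <= B * r ^+ k]].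
  rewrite -ltnS => ltk v Lv; pose o := Ordinal ltk.
  have [q [vE qle]] := Hq o v Lv.
  exists (untag 0 q); split.
  - by rewrite (sum_untag q (F := fun x p => p *: lead_row k (W x))) // => x; rewrite scale0r.
  - rewrite (sum_untag q (F := fun x p => nu p)) => [|x]; last exact: nu0 adm.
    apply: le_trans qle _; rewrite ler_wpM2r ?(row_norm_ge0 adm) //.
    by rewrite (bigD1 o) //= lerDl sumr_ge0.
  move=> x; case: (eqVneq (tag x) o) => [xo|xo]; last by rewrite (untag_dflt 0 q xo) eqxx.
  move=> _; have [Lx sx] := Hw (tag x) (tagged x); split=> //.
    by move=> c; rewrite (leq_trans (sx c)) //; move/(congr1 val): xo => /= ->.
  rewrite /B (bigD1 x) //= mulrDl mulr_suml mulr_sumr.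
  apply: (@le_trans _ _ (\sum_c (\sum_(j < k0) nu (W x 0 c)`_j) * r ^+ k)); last first.
    rewrite lerDl mulr_ge0 ?exprn_ge0 //.
    by do 3![apply: sumr_ge0 => ? _]; exact: nu_ge0 adm _.
  apply: ler_sum => c _; rewrite mulr_sumr mulr_suml.
  rewrite (big_ord_widen_cond k0 xpredT (fun j => r * (nu (W x 0 c)`_j * r ^+ j))) //.
  rewrite big_mkcond; apply: ler_sum => j _; case: ifP => [jk|_].
    rewrite mulrCA ler_wpM2l ?(nu_ge0 adm) // -exprS; exact: ler_weXn2l.
  by rewrite mulr_ge0 ?exprn_ge0 ?(nu_ge0 adm).
have sa c : (size (a 0%R c) <= \max_c size (a 0%R c))%N.
  exact: (leq_bigmax (F := fun c => size (a 0 c))).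
have [q [aE qle]] := reduction sL stable K0 B0 r1 rle divW La sa.
exists q; split=> //; apply: le_trans qle _.
rewrite ler_wpM2l ?mulr_ge0 // /trunc_row_norm /row_norm.
by apply: ler_sum => c _; rewrite (trunc_normE adm).
Qed.
End PolynomialDivision.

Lemma bounded_noetherian_poly (R : realType) (P : comNzRingType)
    (C : {rmorphism R -> P}) (T T' : Type) (ev : T -> P -> R)
    (ev' : T' -> {poly P} -> R) :
  (forall s', exists s x, `|x| <= 1 /\
     forall p, ev' s' p = \sum_(i < size p) ev s p`_i * x ^+ i) ->
  bounded_noetherian C ev -> bounded_noetherian (polyC \o C) ev'.
Proof.
move=> Hev bn D J L sL.
have /choice[k0 stable] j : exists k0, forall k v, (k0 <= k)%N ->
    lead_module (L j) k v -> lead_module (L j) k0 v.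
  apply: chain_stabilizes bn _ _ => [k|k v]; first exact: lead_module_submodule.
  exact: lead_moduleS.
pose m := \max_j k0 j.
have [nu [adm div]] := bn D (J * 'I_m.+1)%type (fun x => lead_module (L x.1) x.2)
  (fun x => lead_module_submodule x.2 (sL x.1)).
have /choice[rho Hrho] j : exists rho, forall r, 1 <= r -> rho <= r ->
    divides_boundedly (poly_norm nu r) (L j).
  apply: (poly_divides_boundedly adm (sL j) (stable j)) => k lek.
  have ltk : (k < m.+1)%N.
    by rewrite ltnS (leq_trans lek) // /m (leq_bigmax (F := k0)).
  exact: (div (j, Ordinal ltk)).
pose r := 1 + \sum_j `|rho j|.
have r1 : 1 <= r by rewrite lerDl sumr_ge0.
exists (poly_norm nu r); split; first exact: (poly_admissible adm r1 Hev).
move=> j; apply: Hrho => //; apply: le_trans (ler_norm _) _.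
by rewrite /r (bigD1 j) //= addrCA lerDl addr_ge0 ?sumr_ge0.
Qed.

(** Iterated univariate polynomials, the newest variable outermost. Evaluation is a morphism at
    every point, but the norms have to dominate it only on the unit cube. *)
Lemma exists_polynomial_ring (R : realType) (N : nat) :
  exists (P : comNzRingType) (C : {rmorphism R -> P}) (X : 'I_N -> P)
    (ev : ('I_N -> R) -> {rmorphism P -> R}),
    [/\ forall s v, ev s (X v) = s v, forall s c, ev s (C c) = c &
      bounded_noetherian C
        (fun s : {s : 'I_N -> R | forall v, `|s v| <= 1} => ev (sval s))].
Proof.
elim: N => [|N [P [C [X [ev [evX evC bn]]]]]].
  exists R, idfun, (fun=> 0), (fun=> idfun); split=> // [s []//|].
  exact: bounded_noetherian_base.
exists {poly P}, (polyC \o C),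
  (fun v => if unlift ord0 v is Some u then (X u)%:P else 'X),
  (fun s => (horner_eval (s ord0) \o map_poly (ev (s \o lift ord0))) : {rmorphism _ -> _}).
split.
- move=> s v /=; rewrite /horner_eval.
  case: unliftP => [u ->|->]; first by rewrite map_polyC hornerC /= evX.
  by rewrite map_polyX hornerX.
- by move=> s c /=; rewrite /horner_eval map_polyC hornerC /= evC.
apply: bounded_noetherian_poly bn => -[s Hs] /=.
exists (exist (fun s : 'I_N -> R => forall v, `|s v| <= 1) (s \o lift ord0)
  (fun v => Hs (lift ord0 v))), (s ord0); split=> // p.
rewrite /horner_eval (horner_coef_wide _ (size_poly _ _)).
by apply: eq_bigr => i _; rewrite coef_map.
Qed.

(** * Power series with polynomial coefficients *)

Section CauchyProduct.
Variable P : nzSemiRingType.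
Implicit Types a b : nat -> P.

Definition conv a b : nat -> P := fun n => \sum_(i < n.+1) a i * b (n - i)%N.
Definition const_series (p : P) : nat -> P := fun n => if n is 0 then p else 0.
Definition shift_series a : nat -> P := fun n => if n is n'.+1 then a n' else 0.
Definition conv_pow a k : nat -> P := iter k (conv a) (const_series 1).

Lemma conv_pow_lt a k n : a 0%N = 0 -> (n < k)%N -> conv_pow a k n = 0.
Proof.
move=> a0; elim: k n => // k IH n nk; rewrite /conv_pow /= /conv big1 // => i _.
case: (posnP i) => [->|i0]; first by rewrite a0 mul0r.
have := IH (n - i)%N; rewrite /conv_pow => ->; rewrite ?mulr0 //.
by have := ltn_ord i; lia.
Qed.

End CauchyProduct.

Section RealEstimates.
Variable R : realType.

Lemma natr_le_expn2 n : n%:R <= 2 ^+ n :> R.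
Proof. by rewrite -natrX ler_nat ltnW // ltn_expl. Qed.

(** Absorbs the number of terms in the truncation error of a Cauchy product: the origin of the
    factor [4] in its rate. *)
Lemma double_square_le n : (n * (n + n))%:R <= 4 ^+ n :> R.
Proof.
rewrite -natrX ler_nat.
elim: n => // n IH; rewrite expnS; case: n IH => [//|[//|n]] IH; nia.
Qed.

(* The difference is the sum of the products of total degree between [N] and [2N]. *)
Lemma cauchy_product_truncation (al be : nat -> R) (K L q : R) N :
  0 <= q -> q <= 1 -> 0 <= K -> 0 <= L ->
  (forall j, `|al j| <= K * q ^+ j) -> (forall j, `|be j| <= L * q ^+ j) ->
  `|(\sum_(j < N) al j) * (\sum_(j < N) be j) - \sum_(n < N) conv al be n|
    <= K * L * (4 * q) ^+ N.
Proof.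
move=> q0 q1 K0 L0 Hal Hbe.
pose p := \poly_(i < N) al i; pose r := \poly_(i < N) be i.
have p1 : \sum_(j < N) al j = p.[1].
  rewrite (horner_coef_wide _ (size_poly _ _)).
  by apply: eq_bigr => i _; rewrite coef_poly ltn_ord expr1n mulr1.
have r1 : \sum_(j < N) be j = r.[1].
  rewrite (horner_coef_wide _ (size_poly _ _)).
  by apply: eq_bigr => i _; rewrite coef_poly ltn_ord expr1n mulr1.
have sz : (size (p * r)%R <= N + N)%N.
  apply: leq_trans (size_polyMleq _ _) _; apply: leq_trans (leq_pred _) _.
  by rewrite leq_add // size_poly.
rewrite p1 r1 -hornerM (horner_coef_wide _ sz) big_split_ord /=.
under eq_bigr do rewrite expr1n mulr1.
under [X in _ + X - _]eq_bigr do rewrite expr1n mulr1.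
have -> : \sum_(i < N) (p * r)`_i = \sum_(n < N) conv al be n.
  apply: eq_bigr => n _; rewrite coefM; apply: eq_bigr => i _.
  rewrite !coef_poly; have := ltn_ord n; have := ltn_ord i; rewrite ltnS => le1 le2.
  by rewrite (leq_ltn_trans le1 le2) (leq_ltn_trans (leq_subr _ _) le2).
rewrite addrC addKr.
have bound j : `|p`_j| <= K * q ^+ j /\ `|r`_j| <= L * q ^+ j.
  by split; rewrite coef_poly; case: ifP; rewrite // normr0 mulr_ge0 ?exprn_ge0.
apply: le_trans (ler_norm_sum _ _ _) _.
apply: (@le_trans _ _ (\sum_(i < N) (N + N)%:R * (K * L * q ^+ N))).
  apply: ler_sum => i _; rewrite coefM.
  apply: le_trans (ler_norm_sum _ _ _) _.
  apply: (@le_trans _ _ (\sum_(j < (N + i).+1) K * L * q ^+ N)).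
    apply: ler_sum => j _; rewrite normrM.
    apply: (@le_trans _ _ ((K * q ^+ j) * (L * q ^+ (N + i - j)))).
      by apply: ler_pM; rewrite ?normr_ge0 //; case: (bound j); case: (bound (N + i - j)%N).
    rewrite mulrACA -exprD subnKC; last by rewrite -ltnS.
    by rewrite ler_wpM2l ?mulr_ge0 // ler_wiXn2l // leq_addr.
  rewrite sumr_const card_ord -[leLHS]mulr_natl ler_wpM2r ?mulr_ge0 ?exprn_ge0 //.
  by rewrite ler_nat -addnS leq_add2l.
rewrite sumr_const card_ord -[leLHS]mulr_natl mulrA -natrM mulrCA exprMn.
rewrite ler_wpM2l ?mulr_ge0 // ler_wpM2r ?exprn_ge0 //.
exact: double_square_le.
Qed.

Lemma cauchy_product_error (f g : R) (al be : nat -> R) (K L e1 e2 q : R) N :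
  0 <= q -> q <= 1 -> 0 <= K -> 0 <= L ->
  (forall j, `|al j| <= K * q ^+ j) -> (forall j, `|be j| <= L * q ^+ j) ->
  `|f - \sum_(j < N) al j| <= e1 -> `|g - \sum_(j < N) be j| <= e2 -> 
  `|f * g - \sum_(n < N) conv al be n|
    <= e1 * `|g| + (`|f| + e1) * e2 + K * L * (4 * q) ^+ N.
Proof.
move=> q0 q1 K0 L0 Hal Hbe He1 He2.
have T := cauchy_product_truncation N q0 q1 K0 L0 Hal Hbe.
set A := \sum_(j < N) al j in He1 T *; set B := \sum_(j < N) be j in He2 T *.
set S := \sum_(n < N) _ in T *.
have -> : f * g - S = (f - A) * g + A * (g - B) + (A * B - S) by ring.
apply: le_trans (ler_normD _ _) _; apply: lerD T.
apply: le_trans (ler_normD _ _) _; rewrite !normrM; apply: lerD.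
  by rewrite ler_wpM2r.
apply: ler_pM => //.
have -> : A = f - (f - A) by ring.
by apply: le_trans (ler_normB _ _) _; rewrite lerD2l.
Qed.

End RealEstimates.

(** * Functions represented by power series, uniformly in the parameter *)

Section Representation.
Variables (R : realType) (P : comNzRingType) (C : {rmorphism R -> P}) (T : Type)
  (ev : T -> {rmorphism P -> R}) (eta : T -> R) (nu : P -> R).
Hypothesis adm : admissible C ev nu.
Hypothesis evC : forall s c, ev s (C c) = c.
Hypothesis eta_gt0 : forall s, 0 < eta s.
Implicit Types (a b : nat -> P) (F G : T -> R).

Definition psum s a N := \sum_(j < N) ev s (a j) * eta s ^+ j.

(* [F s] is the sum of the power series [a], specialized at [s], with explicit
   geometric control of the coefficients and of the remainders. *)
Definition represents_with K Q a F :=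
  [/\ 1 <= K, 1 <= Q, forall j, nu (a j) <= K * Q ^+ j &
    forall s, Q * eta s <= 1 -> forall N,
      `|F s - psum s a N| <= K * (Q * eta s) ^+ N].

Definition represents a F := exists K Q, represents_with K Q a F.

Lemma represents_weaken K Q K' Q' a F :
  represents_with K Q a F -> K <= K' -> Q <= Q' -> represents_with K' Q' a F.
Proof.
move=> [K1 Q1 Ha HF] KK QQ.
have K0 : 0 <= K by exact: le_trans K1.
have Q0 : 0 <= Q by exact: le_trans Q1.
have K0' : 0 <= K' by exact: le_trans KK.
split; [exact: le_trans KK | exact: le_trans QQ | move=> j | move=> s small N].
  apply: le_trans (Ha j) _; apply: ler_pM => //; rewrite ?exprn_ge0 //.
  by rewrite lerXn2r // nnegrE (le_trans Q0).
have e0 := ltW (eta_gt0 s).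
have QQe : Q * eta s <= Q' * eta s by rewrite ler_wpM2r.
apply: le_trans (HF _ (le_trans QQe small) N) _.
apply: ler_pM => //; rewrite ?exprn_ge0 ?mulr_ge0 //.
by rewrite lerXn2r // nnegrE ?mulr_ge0 // (le_trans Q0).
Qed.

Lemma represents_ext a F G : F =1 G -> represents a F -> represents a G.
Proof.
by move=> FG [K [Q [K1 Q1 Ha HF]]]; exists K, Q; split=> // s; rewrite -FG; exact: HF.
Qed.

Lemma represents_const p : represents (const_series p) (fun s => ev s p).
Proof.
have n0 := nu_ge0 adm p.
exists (1 + nu p), 1; split; [by rewrite lerDl | by [] | move=> j | move=> s small N].
  rewrite expr1n mulr1; case: j => [|j] /=; first by rewrite lerDr.
  by rewrite (nu0 adm) addr_ge0.
have e0 : 0 <= eta s := ltW (eta_gt0 s).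
case: N => [|N].
  rewrite /psum big_ord0 subr0 mulr1; apply: le_trans (nu_ev adm s p) _.
  by rewrite lerDr.
rewrite /psum big_ord_recl big1 => [|i _]; last by rewrite rmorph0 mul0r.
by rewrite expr0 mulr1 addr0 subrr normr0 !mulr_ge0 ?exprn_ge0 ?addr_ge0 ?mulr_ge0.
Qed.

Lemma represents_add a b F G : represents a F -> represents b G ->
  represents (fun n => a n + b n) (fun s => F s + G s).
Proof.
move=> [K [Q rF]] [L [Q' rG]].
have [K1 Q1 _ _] := rF; have [L1 Q1' _ _] := rG.
have [_ _ Ha HF] := represents_weaken (Q' := Q + Q') rF (lexx K) ltac:(lra).
have [_ _ Hb HG] := represents_weaken (Q' := Q + Q') rG (lexx L) ltac:(lra).
exists (K + L), (Q + Q'); split; [lra | lra | move=> j | move=> s small N].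
  by apply: le_trans (nuD adm _ _) _; rewrite mulrDl lerD.
have -> : F s + G s - psum s (fun n => a n + b n) N
     = (F s - psum s a N) + (G s - psum s b N).
  rewrite addrACA -opprD -big_split /=; congr (_ - _).
  by apply: eq_bigr => j _; rewrite rmorphD mulrDl.
by apply: le_trans (ler_normD _ _) _; rewrite mulrDl lerD ?HF ?HG.
Qed.

Lemma represents_scale p a F : represents a F ->
  represents (fun n => p * a n) (fun s => ev s p * F s).
Proof.
move=> [K [Q [K1 Q1 Ha HF]]]; have n0 := nu_ge0 adm p.
have K0 : 0 <= K by lra.
exists ((1 + nu p) * K), Q; split=> //; [nra | move=> j | move=> s small N].
  apply: le_trans (nuM adm _ _) _; rewrite -mulrA; apply: ler_pM => //; last lra.
  exact: nu_ge0 adm _.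
have -> : psum s (fun n => p * a n) N = ev s p * psum s a N.
  by rewrite mulr_sumr; apply: eq_bigr => j _; rewrite rmorphM mulrA.
rewrite -mulrBr normrM -mulrA; apply: ler_pM => //; last exact: HF.
by apply: le_trans (nu_ev adm s p) _; rewrite lerDr.
Qed.

Lemma represents_sub a b F G : represents a F -> represents b G ->
  represents (fun n => a n - b n) (fun s => F s - G s).
Proof.
move=> rF rG.
have := represents_add rF (represents_scale (C (-1)) rG).
rewrite rmorphN rmorph1; under [X in represents X]funext do rewrite mulN1r.
by apply: represents_ext => s; rewrite rmorphN rmorph1 mulN1r.
Qed.

Lemma represents_shift a F : represents a F ->
  represents (shift_series a) (fun s => eta s * F s).
Proof.
move=> [K [Q [K1 Q1 Ha HF]]]; exists K, Q; split=> // [[|j] /=|s small N].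
- by rewrite (nu0 adm) expr0; lra.
- apply: le_trans (Ha j) _; rewrite exprS ler_wpM2l ?ler_peMl ?exprn_ge0 //; lra.
have e0 := eta_gt0 s.
case: N => [|N].
  rewrite /psum big_ord0 subr0 mulr1; have := HF s small 0%N.
  rewrite /psum big_ord0 subr0 mulr1 normrM gtr0_norm // => FK.
  have : eta s <= 1 by apply: le_trans small; rewrite ler_peMl // ltW.
  have := normr_ge0 (F s); nra.
have -> : psum s (shift_series a) N.+1 = eta s * psum s a N.
  rewrite /psum big_ord_recl /= rmorph0 mul0r add0r mulr_sumr.
  by apply: eq_bigr => j _; rewrite /= exprS mulrCA.
rewrite -mulrBr normrM gtr0_norm //.
apply: le_trans (ler_wpM2l (ltW e0) (HF s small N)) _.
rewrite mulrCA exprS ler_wpM2l //; first lra.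
by rewrite ler_wpM2r ?exprn_ge0 ?mulr_ge0 ?ler_peMl ?(ltW e0) //; lra.
Qed.

Lemma psum_conv s a b N : psum s (conv a b) N =
  \sum_(n < N) conv (fun j => ev s (a j) * eta s ^+ j)
                    (fun j => ev s (b j) * eta s ^+ j) n.
Proof.
apply: eq_bigr => n _; rewrite rmorph_sum mulr_suml; apply: eq_bigr => i _.
by rewrite rmorphM mulrACA -exprD subnKC // -ltnS.
Qed.

Lemma nu_conv a b K L Q : 0 <= K -> 0 <= L -> 0 <= Q ->
  (forall j, nu (a j) <= K * Q ^+ j) -> (forall j, nu (b j) <= L * Q ^+ j) ->
  forall n, nu (conv a b n) <= K * L * (2 * Q) ^+ n.
Proof.
move=> K0 L0 Q0 Ha Hb n; apply: le_trans (nu_sum adm _ _ _) _.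
apply: (@le_trans _ _ (\sum_(i < n.+1) K * L * Q ^+ n)).
  apply: ler_sum => i _; apply: le_trans (nuM adm _ _) _.
  apply: (@le_trans _ _ ((K * Q ^+ i) * (L * Q ^+ (n - i)))).
    by apply: ler_pM; rewrite ?(nu_ge0 adm).
  by rewrite mulrACA -exprD subnKC // -ltnS.
rewrite sumr_const card_ord -[leLHS]mulr_natl mulrCA exprMn.
rewrite ler_wpM2l ?mulr_ge0 // ler_wpM2r ?exprn_ge0 //.
by rewrite -natrX ler_nat ltn_expl.
Qed.

Lemma term_bound a K Q s : (forall j, nu (a j) <= K * Q ^+ j) ->
  forall j, `|ev s (a j) * eta s ^+ j| <= K * (Q * eta s) ^+ j.
Proof.
move=> Ha j; have e0 := ltW (eta_gt0 s).
rewrite normrM normrX (ger0_norm e0) exprMn mulrA ler_wpM2r ?exprn_ge0 //.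
exact: le_trans (nu_ev adm s _) (Ha j).
Qed.

Lemma represents_bound K Q a F s : represents_with K Q a F -> Q * eta s <= 1 ->
  `|F s| <= K.
Proof.
by move=> [_ _ _ /[apply]/(_ 0%N)]; rewrite /psum big_ord0 subr0 mulr1.
Qed.

Lemma represents_conv a b F G : represents a F -> represents b G ->
  represents (conv a b) (fun s => F s * G s).
Proof.
move=> [K [Q rF]] [L [Q' rG]].
have [K1 Q1 _ _] := rF; have [L1 Q1' _ _] := rG.
have {}rF := represents_weaken (Q' := Q + Q') rF (lexx K) ltac:(lra).
have {}rG := represents_weaken (Q' := Q + Q') rG (lexx L) ltac:(lra).
move: (Q + Q') rF rG => {Q Q' Q1 Q1'} Q rF rG.
have [_ Q1 Ha HF] := rF; have [_ _ Hb HG] := rG.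
have K0 : 0 <= K by lra. have L0 : 0 <= L by lra. have Q0 : 0 <= Q by lra.
have KL0 : 0 <= K * L by exact: mulr_ge0.
(* The three parts of the product error weigh 1, 2 and 1; the rate [4 * Q] is that of the truncated
   Cauchy product. *)
exists (4 * (K * L)), (4 * Q); split; [nra | lra | move=> j | move=> s small N].
  apply: le_trans (nu_conv K0 L0 Q0 Ha Hb j) _.
  apply: ler_pM; rewrite ?exprn_ge0 ?mulr_ge0 //; first lra.
  by rewrite lerXn2r ?nnegrE ?mulr_ge0 // ler_wpM2r //; lra.
have e0 := ltW (eta_gt0 s).
have q0 : 0 <= Q * eta s by exact: mulr_ge0.
have q1 : Q * eta s <= 1 by apply: le_trans small; rewrite -mulrA; lra.
rewrite psum_conv.
have -> : 4 * (K * L) * (4 * Q * eta s) ^+ N = 4 * (K * L * (4 * (Q * eta s)) ^+ N).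
  by rewrite -[4 * Q * _]mulrA -[4 * (K * L) * _]mulrA.
apply: le_trans (cauchy_product_error q0 q1 K0 L0 (term_bound _ Ha) (term_bound _ Hb)
  (HF s q1 N) (HG s q1 N)) _.
set q := Q * eta s in q0 q1 *.
have qN : q ^+ N <= (4 * q) ^+ N by rewrite lerXn2r ?nnegrE ?mulr_ge0 //; lra.
have qN0 : 0 <= q ^+ N by exact: exprn_ge0.
have qN1 : q ^+ N <= 1 by exact: exprn_ile1.
have FK := represents_bound rF q1; have GL := represents_bound rG q1.
have t1 : K * q ^+ N * `|G s| <= K * L * (4 * q) ^+ N.
  by rewrite mulrAC; apply: ler_pM; rewrite ?mulr_ge0 // ler_wpM2l.
have t2 : (`|F s| + K * q ^+ N) * (L * q ^+ N) <= 2 * (K * L * (4 * q) ^+ N).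
  apply: (@le_trans _ _ ((2 * K) * (L * q ^+ N))).
    rewrite ler_wpM2r ?mulr_ge0 //; have : K * q ^+ N <= K by rewrite ler_piMr.
    lra.
  by rewrite -!mulrA ler_wpM2l // ler_wpM2l // ler_wpM2l.
lra.
Qed.

Lemma represents_sum (I : Type) (r : seq I) (S : pred I) (a : I -> nat -> P)
    (F : I -> T -> R) : (forall i, represents (a i) (F i)) ->
  represents (fun n => \sum_(i <- r | S i) a i n) (fun s => \sum_(i <- r | S i) F i s).
Proof.
move=> H; elim: r => [|i r IH].
  have -> : (fun n => \sum_(i <- [::] | S i) a i n) = const_series 0.
    by apply: funext => -[|n]; rewrite big_nil.
  by apply: represents_ext (represents_const 0) => s; rewrite big_nil rmorph0.
under [X in represents X]funext do rewrite big_cons.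
under [X in represents _ X]funext do rewrite big_cons.
by case: (S i) => //; apply: represents_add.
Qed.

Lemma represents_prod (I : Type) (r : seq I) (S : pred I) (a : I -> nat -> P)
    (F : I -> T -> R) : (forall i, represents (a i) (F i)) ->
  represents (\big[@conv P/const_series 1]_(i <- r | S i) a i)
    (fun s => \prod_(i <- r | S i) F i s).
Proof.
move=> H; elim: r => [|i r IH].
  by rewrite big_nil; apply: represents_ext (represents_const 1) => s; rewrite big_nil rmorph1.
rewrite big_cons; under [X in represents _ X]funext do rewrite big_cons.
by case: (S i) => //; apply: represents_conv.
Qed.

(** The remainder of the quotient at order [N] is that of [F] at order [k + N], divided by
    [eta s ^+ k]; this leaves the constant [K * Q ^+ k]. *)
Lemma represents_unshift a F k : represents a F -> (forall j, (j < k)%N -> a j = 0) ->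
  represents (fun j => a (k + j)%N) (fun s => F s / eta s ^+ k).
Proof.
move=> [K [Q [K1 Q1 Ha HF]]] a0; exists (K * Q ^+ k), Q.
have Qk : 1 <= Q ^+ k by exact: exprn_ege1.
split=> // [|j|s small N]; first nra.
  by rewrite -mulrA -exprD.
have e0 : 0 < eta s ^+ k by rewrite exprn_gt0.
have -> : psum s (fun j => a (k + j)%N) N = psum s a (k + N) / eta s ^+ k.
  rewrite /psum big_split_ord /= [X in (X + _) / _]big1 ?add0r => [|i _].
    rewrite mulr_suml; apply: eq_bigr => i _.
    by rewrite exprD [in RHS]mulrCA [in RHS]mulrC mulKf // gt_eqF.
  by rewrite a0 // rmorph0 mul0r.
rewrite -mulrBl normrM [X in _ * X]gtr0_norm ?invr_gt0 // ler_pdivrMr //.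
apply: le_trans (HF s small _) _.
by rewrite exprD [(Q * _) ^+ k]exprMn le_eqVlt; apply/predU1l; ring.
Qed.

(** * Composition with an analytic function of one variable *)

Section Composition.
Variables (al : nat -> R) (phi : R -> R).
Hypothesis al1 : forall i, `|al i| <= 1.
Hypothesis phiE : forall v, `|v| <= 2^-1 -> forall N,
  `|phi v - \sum_(i < N) al i * v ^+ i| <= 2 * `|v| ^+ N.

(** When [a 0 = 0] the [i]-th power starts in degree [i], so the sum may stop at [n]. *)
Definition comp_series a : nat -> P :=
  fun n => \sum_(i < n.+1) C (al i) * conv_pow a i n.

(** The rate [2 * Q] does not depend on [i], whereas iterating [nu_conv] would double it at each
    factor. Giving the first factor the smaller rate [Q] makes the sum over [j] a geometric one. *)
Lemma nu_conv_pow a K Q : 0 <= K -> 0 <= Q ->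
  (forall j, nu (a j) <= K * Q ^+ j) ->
  forall i n, nu (conv_pow a i n) <= (2 * K) ^+ i * (2 * Q) ^+ n.
Proof.
move=> K0 Q0 Ha; elim=> [|i IH] n.
  rewrite expr0 mul1r; case: n => [|n] /=; first by rewrite expr0; exact: nu1 adm.
  by rewrite (nu0 adm) exprn_ge0 ?mulr_ge0.
have Q20 : 0 <= 2 * Q by rewrite mulr_ge0.
have K20 : 0 <= 2 * K by rewrite mulr_ge0.
apply: le_trans (nu_sum adm _ _ _) _.
apply: (@le_trans _ _ (\sum_(j < n.+1) (K * (2 * K) ^+ i * Q ^+ n) * 2 ^+ (n - j))).
  apply: ler_sum => j _; apply: le_trans (nuM adm _ _) _.
  apply: (@le_trans _ _ ((K * Q ^+ j) * ((2 * K) ^+ i * (2 * Q) ^+ (n - j)))).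
    by apply: ler_pM; rewrite ?(nu_ge0 adm) //; exact: IH.
  have jn : (j <= n)%N by rewrite -ltnS.
  have -> : Q ^+ n = Q ^+ j * Q ^+ (n - j) by rewrite -exprD subnKC.
  by rewrite [(2 * Q) ^+ _]exprMn le_eqVlt; apply/predU1l; ring.
have -> : (2 * K) ^+ i.+1 * (2 * Q) ^+ n = (K * (2 * K) ^+ i * Q ^+ n) * (2 * 2 ^+ n).
  by rewrite exprS [(2 * Q) ^+ _]exprMn; ring.
rewrite -mulr_sumr ler_wpM2l ?mulr_ge0 ?exprn_ge0 //.
elim: n {IH} => [|n IHn]; first by rewrite big_ord1 subnn expr0 mulr1 ler1n.
rewrite big_ord_recl subn0.
have -> : 2 * 2 ^+ n.+1 = 2 ^+ n.+1 + 2 * 2 ^+ n :> R by rewrite exprS; ring.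
by rewrite lerD2l; under eq_bigr do rewrite subSS.
Qed.

(** Here too the rate must be independent of [i]: only the constant may grow with the power, and it
    is absorbed in the composition because just the powers [i < N] occur. *)
Lemma conv_pow_error K Q a F s i N : represents_with K Q a F -> 2 * Q * eta s <= 1 ->
  `|F s ^+ i - psum s (conv_pow a i) N| <= (4 * K) ^+ i * (8 * Q * eta s) ^+ N.
Proof.
move=> rF small; have [K1 Q1 Ha HF] := rF.
have e0 := ltW (eta_gt0 s).
have K0 : 0 <= K by lra. have Q0 : 0 <= Q by lra.
have Qe0 : 0 <= Q * eta s by rewrite mulr_ge0.
have Qe1 : Q * eta s <= 1 by lra.
have FK := represents_bound rF Qe1.
elim: i => [|i IH].
  rewrite !expr0 mul1r /psum; case: N => [|N]; first by rewrite big_ord0 subr0 normr1.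
  rewrite big_ord_recl big1 => [|j _]; last by rewrite /= rmorph0 mul0r.
  by rewrite /= rmorph1 mul1r addr0 subrr normr0 exprn_ge0 // -mulrA mulr_ge0.
rewrite exprS psum_conv.
have Ha2 j : nu (a j) <= K * (2 * Q) ^+ j.
  apply: le_trans (Ha j) _; rewrite ler_wpM2l // lerXn2r ?nnegrE ?mulr_ge0 //; lra.
have q0 : 0 <= 2 * Q * eta s by rewrite -mulrA mulr_ge0.
have L0 : 0 <= (2 * K) ^+ i by rewrite exprn_ge0 ?mulr_ge0.
have := cauchy_product_error q0 small K0 L0 (term_bound _ Ha2)
  (term_bound _ (nu_conv_pow K0 Q0 Ha i)) (HF s Qe1 N) IH.
move=> /le_trans; apply.
have -> : 4 * (2 * Q * eta s) = 8 * Q * eta s by ring.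
have qN1 : (Q * eta s) ^+ N <= 1 by exact: exprn_ile1.
have qN : (Q * eta s) ^+ N <= (8 * Q * eta s) ^+ N.
  by rewrite lerXn2r ?nnegrE ?mulr_ge0 //; lra.
have KN : K * (Q * eta s) ^+ N <= K by rewrite ler_piMr.
set t := (8 * Q * eta s) ^+ N in IH qN *.
have t0 : 0 <= t by rewrite exprn_ge0 ?mulr_ge0.
have KK : 0 <= K * K ^+ i by rewrite mulr_ge0 ?exprn_ge0.
have e1 : K * (Q * eta s) ^+ N * `|F s ^+ i| <= K * K ^+ i * t.
  rewrite mulrAC; apply: ler_pM; rewrite ?mulr_ge0 ?exprn_ge0 //.
  by rewrite ler_wpM2l // normrX lerXn2r ?nnegrE.
have e2 : (`|F s| + K * (Q * eta s) ^+ N) * ((4 * K) ^+ i * t)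
    <= 2 * 4 ^+ i * (K * K ^+ i * t).
  apply: (@le_trans _ _ (2 * K * ((4 * K) ^+ i * t))).
    by rewrite ler_wpM2r ?mulr_ge0 ?exprn_ge0 ?mulr_ge0 //; lra.
  by rewrite exprMn le_eqVlt; apply/predU1l; ring.
have e3 : K * (2 * K) ^+ i * t = 2 ^+ i * (K * K ^+ i * t) by rewrite exprMn; ring.
have -> : (4 * K) ^+ i.+1 * t = 4 * 4 ^+ i * (K * K ^+ i * t).
  by rewrite exprS exprMn; ring.
rewrite e3; have p4 : 1 <= 4 ^+ i :> R by rewrite exprn_ege1 //; lra.
have p2 : 2 ^+ i <= 4 ^+ i :> R by rewrite lerXn2r ?nnegrE //; lra.
have W0 : 0 <= K * K ^+ i * t by rewrite mulr_ge0.
set W := K * K ^+ i * t in e1 e2 W0 *.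
have g1 : 2 ^+ i * W <= 4 ^+ i * W by rewrite ler_wpM2r.
have g2 : W <= 4 ^+ i * W by rewrite ler_peMl.
lra.
Qed.

Lemma represents_comp a F : represents a F -> a 0%N = 0 ->
  represents (comp_series a) (fun s => phi (F s)).
Proof.
move=> [K [Q rF]] a0; have [K1 Q1 Ha HF] := rF.
have K0 : 0 <= K by lra. have Q0 : 0 <= Q by lra.
have KQ : 1 <= K * Q by nra.
(* [64 = 2 * 4 * 8]: the factor 2 for the number of powers, [4 * K] and [8 * Q] from
   [conv_pow_error]. In the constant, 2 comes from the remainder of [phi] and 1 from the errors on
   the powers. *)
exists 3, (64 * K * Q); split; [lra | lra | move=> n | move=> s small N].
  apply: le_trans (nu_sum adm _ _ _) _.
  apply: (@le_trans _ _ (\sum_(i < n.+1) (2 * K) ^+ n * (2 * Q) ^+ n)).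
    apply: ler_sum => i _; apply: le_trans (nuCM adm _ _) _.
    rewrite -[leRHS]mul1r; apply: ler_pM; rewrite ?(nu_ge0 adm) //.
    apply: le_trans (nu_conv_pow K0 Q0 Ha i n) _.
    rewrite ler_wpM2r ?exprn_ge0 ?mulr_ge0 // ler_weXn2l //; first lra.
    by rewrite -ltnS.
  rewrite sumr_const card_ord -[leLHS]mulr_natl -exprMn.
  apply: (@le_trans _ _ (2 ^+ n.+1 * (2 * K * (2 * Q)) ^+ n)).
    by rewrite ler_wpM2r ?exprn_ge0 ?mulr_ge0 ?mulr_ge0 // natr_le_expn2.
  rewrite exprS -mulrA -exprMn; apply: ler_pM => //.
  - by rewrite exprn_ge0 ?mulr_ge0 ?mulr_ge0.
  - lra.
  - by rewrite lerXn2r ?nnegrE ?mulr_ge0 //; nra.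
have e0 := ltW (eta_gt0 s).
have Qe0 : 0 <= Q * eta s by rewrite mulr_ge0.
have KQe : 64 * (K * (Q * eta s)) <= 1 by rewrite !mulrA.
have Qe : Q * eta s <= K * (Q * eta s) by rewrite ler_peMl.
have Qs : 2 * Q * eta s <= 1 by rewrite -mulrA; lra.
(* The vanishing constant term makes [F s] of size [eta s], hence inside the disc where [phiE]
   applies. *)
have Fs : `|F s| <= K * (Q * eta s).
  have := HF s ltac:(lra) 1%N.
  by rewrite /psum big_ord1 a0 rmorph0 mul0r subr0.
have E : psum s (comp_series a) N = \sum_(i < N) al i * psum s (conv_pow a i) N.
  transitivity (\sum_(n < N) \sum_(i < N) al i * (ev s (conv_pow a i n) * eta s ^+ n)).
    apply: eq_bigr => n _; rewrite rmorph_sum mulr_suml.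
    rewrite (big_ord_widen_cond N xpredT
      (fun i => ev s (C (al i) * conv_pow a i n) * eta s ^+ n)) //.
    rewrite big_mkcond; apply: eq_bigr => i _; case: ifP => [_|/negbT].
      by rewrite rmorphM evC mulrA.
    by rewrite -leqNgt => lt; rewrite conv_pow_lt // rmorph0 mul0r mulr0.
  by rewrite exchange_big; apply: eq_bigr => i _; rewrite mulr_sumr.
rewrite E.
have -> : phi (F s) - \sum_(i < N) al i * psum s (conv_pow a i) N =
    (phi (F s) - \sum_(i < N) al i * F s ^+ i)
    + \sum_(i < N) al i * (F s ^+ i - psum s (conv_pow a i) N).
  under [X in _ = _ + X]eq_bigr do rewrite mulrBr.
  by rewrite sumrB; ring.
apply: le_trans (ler_normD _ _) _.
have p1 : `|phi (F s) - \sum_(i < N) al i * F s ^+ i| <= 2 * (64 * K * Q * eta s) ^+ N.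
  apply: le_trans (phiE _ _) _; first lra.
  rewrite ler_wpM2l // lerXn2r ?nnegrE ?mulr_ge0 //.
  by apply: le_trans Fs _; rewrite !mulrA -!mulrA; lra.
have p2 : `|\sum_(i < N) al i * (F s ^+ i - psum s (conv_pow a i) N)|
    <= (64 * K * Q * eta s) ^+ N.
  apply: le_trans (ler_norm_sum _ _ _) _.
  apply: (@le_trans _ _ (\sum_(i < N) (4 * K) ^+ N * (8 * Q * eta s) ^+ N)).
    apply: ler_sum => i _; rewrite normrM -[leRHS]mul1r; apply: ler_pM => //.
    apply: le_trans (conv_pow_error _ _ rF Qs) _.
    rewrite ler_wpM2r ?exprn_ge0 -?mulrA ?mulr_ge0 // ler_weXn2l //; first lra.
    by rewrite ltnW.
  rewrite sumr_const card_ord -[leLHS]mulr_natl -exprMn.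
  apply: (@le_trans _ _ (2 ^+ N * (4 * K * (8 * Q * eta s)) ^+ N)).
    by rewrite ler_wpM2r ?natr_le_expn2 // exprn_ge0 // !mulr_ge0.
  rewrite -exprMn le_eqVlt; apply/predU1l; congr (_ ^+ _); ring.
lra.
Qed.

End Composition.
End Representation.

(** * Finite differences of power series *)

Section FiniteDifferenceTheory.
Variable V : zmodType.
Implicit Types f g : nat -> V.

Lemma fdiffnS k f s : fdiffn k.+1 f s = fdiffn k f s.+1 - fdiffn k f s.
Proof. by []. Qed.

Lemma fdiffnSr k f : fdiffn k.+1 f = fdiffn k (fdiff f).
Proof. by rewrite /fdiffn iterSr. Qed.

Lemma fdiffn_shift j f s : fdiffn j (fun u => f u.+1) s = fdiffn j f s.+1.
Proof. by elim: j s => // j IH s; rewrite !fdiffnS !IH. Qed.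

Lemma fdiffnD j f g s : fdiffn j (fun u => f u + g u) s = fdiffn j f s + fdiffn j g s.
Proof. by elim: j s => // j IH s; rewrite !fdiffnS !IH opprD addrACA. Qed.

Lemma fdiffn0 j s : fdiffn j (fun=> 0 : V) s = 0.
Proof. by elim: j s => // j IH s; rewrite fdiffnS !IH subr0. Qed.

Lemma fdiffn_cst j v s : fdiffn j.+1 (fun=> v : V) s = 0.
Proof.
rewrite fdiffnSr (_ : fdiff _ = fun=> 0) ?fdiffn0 //.
by apply: funext => u; rewrite /fdiff subrr.
Qed.

Lemma fdiffn_sum (I : Type) (r : seq I) (S : pred I) j (f : I -> nat -> V) s :
  fdiffn j (fun u => \sum_(i <- r | S i) f i u) s = \sum_(i <- r | S i) fdiffn j (f i) s.
Proof. by elim: j s => // j IH s; rewrite fdiffnS !IH -sumrB. Qed.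

End FiniteDifferenceTheory.

Lemma fdiffn_morph (V W : zmodType) (h : V -> W) j (f : nat -> V) s : {morph h : x y / x - y} ->
  fdiffn j (fun u => h (f u)) s = h (fdiffn j (f : nat -> V) s).
Proof. by move=> hB; elim: j s => // j IH s; rewrite !fdiffnS !IH hB. Qed.

Section SmoothSequences.
Variables (R : realType) (P : comNzRingType) (C : {rmorphism R -> P}).
Implicit Types f g : nat -> nat -> P.

(* The [j]-th difference in [s] of the power series [f s] is divisible by
   [eta ^ (p + j)], for [j <= k] and for all [s >= j + b - 1]. *)
Definition smooth k p b f := forall j s n, (j <= k)%N -> (j + b <= s.+1)%N ->
  (n < p + j)%N -> fdiffn j (f^~ n) s = 0.

Lemma smooth_weaken k p b k' p' b' f : (k' <= k)%N -> (p' <= p)%N -> (b <= b')%N ->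
  smooth k p b f -> smooth k' p' b' f.
Proof. by move=> lk lp lb sf j s n le1 le2 le3; apply: sf; lia. Qed.

Lemma smooth_add k p b f g : smooth k p b f -> smooth k p b g ->
  smooth k p b (fun s n => f s n + g s n).
Proof. by move=> sf sg j s n *; rewrite fdiffnD sf ?sg ?addr0. Qed.

Lemma smooth_scale q k p b f : smooth k p b f -> smooth k p b (fun s n => q * f s n).
Proof.
by move=> sf j s n *; rewrite (fdiffn_morph (h := *%R q)) ?sf ?mulr0 //; exact: mulrBr.
Qed.

Lemma smooth_sub k p b f g : smooth k p b f -> smooth k p b g ->
  smooth k p b (fun s n => f s n - g s n).
Proof.
move=> sf sg.
have -> : (fun s n => f s n - g s n) = (fun s n => f s n + -1 * g s n).
  by apply: funext => s; apply: funext => n; rewrite mulN1r.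
exact: smooth_add sf (smooth_scale (-1) sg).
Qed.

Lemma smooth_cst k b (a : nat -> P) : smooth k 0 b (fun=> a).
Proof. by case=> [|j] s n // *; rewrite fdiffn_cst. Qed.

Lemma smooth_diff k p b f : smooth k.+1 p b f ->
  smooth k p.+1 b.+1 (fun s n => f s.+1 n - f s n).
Proof.
by move=> sf j s n *; have := sf j.+1 s n; rewrite fdiffnSr; apply; lia.
Qed.

(** Order 0 with [p = 0] claims nothing, so one order is gained without information on [f]
    itself. *)
Lemma smooth_integrate k f : smooth k 1 1 (fun s n => f s.+1 n - f s n) ->
  smooth k.+1 0 0 f.
Proof.
move=> sf [|j] s n // le1 le2 le3; rewrite fdiffnSr; apply: sf; lia.
Qed.

Lemma smooth_succ k p b f : smooth k p b f -> smooth k p b.-1 (fun s => f s.+1).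
Proof. move=> sf j s n *; rewrite (fdiffn_shift j (f^~ n)); apply: sf; lia. Qed.

Lemma smooth_shift k p b f : smooth k p b f -> smooth k p.+1 b (fun s => shift_series (f s)).
Proof. by move=> sf j s [|n] *; [exact: fdiffn0 | apply: sf; lia]. Qed.

(** Induction on [k] by the discrete Leibniz rule, in which one factor is shifted by one step; the
    order in [eta] of a product is at least the sum of the orders. *)
Lemma smooth_conv k p q b f g : smooth k p b f -> smooth k q b g ->
  smooth k (p + q) b (fun s => conv (f s) (g s)).
Proof.
have base k' p' q' b' f' g' s n : smooth k' p' b' f' -> smooth k' q' b' g' ->
    (b' <= s.+1)%N -> (n < p' + q')%N -> conv (f' s) (g' s) n = 0.
  move=> sf sg les ltn; rewrite /conv big1 // => i _.
  have [lt|ge] := ltnP i p'.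
    by have /= -> := sf 0%N s i; rewrite ?mul0r //; lia.
  have := ltn_ord i => lti.
  have /= -> := sg 0%N s (n - i)%N; rewrite ?mulr0 //; lia.
elim: k p q b f g => [|k IH] p q b f g sf sg [|j] s n // lej les ltn.
- by apply: base sf sg _ _; lia.
- by apply: base sf sg _ _; lia.
rewrite fdiffnSr.
rewrite (_ : fdiff _ = fun s => conv (fun n => f s.+1 n - f s n) (g s.+1) n
    + conv (f s) (fun n => g s.+1 n - g s n) n); last first.
  apply: funext => u; rewrite /fdiff /conv -sumrB -big_split.
  by apply: eq_bigr => i _ /=; ring.
have sf' := smooth_diff sf; have sg' := smooth_diff sg.
rewrite fdiffnD.
have -> : fdiffn j (fun s => conv (fun n => f s.+1 n - f s n) (g s.+1) n) s = 0.
  apply: (IH p.+1 q b.+1 _ _ sf') => //; try lia.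
  by apply: (smooth_weaken (k := k.+1) (p := q) (b := b.-1)) (smooth_succ sg); lia.
rewrite add0r; apply: (IH p q.+1 b.+1 _ _ _ sg') => //; try lia.
by apply: (smooth_weaken (k := k.+1) (p := p) (b := b)) sf; lia.
Qed.

Lemma smooth_sum (I : Type) (r : seq I) (S : pred I) k p b (f : I -> nat -> nat -> P) :
  (forall i, smooth k p b (f i)) ->
  smooth k p b (fun s n => \sum_(i <- r | S i) f i s n).
Proof. by move=> sf j s n *; rewrite fdiffn_sum big1 // => i _; apply: sf. Qed.

Lemma smooth_prod (I : Type) (r : seq I) (S : pred I) k b (f : I -> nat -> nat -> P) :
  (forall i, smooth k 0 b (f i)) ->
  smooth k 0 b (fun s => \big[@conv P/const_series 1]_(i <- r | S i) f i s).
Proof.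
move=> sf; elim: r => [|i r IH].
  under [X in smooth _ _ _ X]funext do rewrite big_nil.
  exact: smooth_cst.
under [X in smooth _ _ _ X]funext do rewrite big_cons.
by case: (S i) => //; apply: (smooth_conv (p := 0)).
Qed.

Lemma smooth_comp (al : nat -> R) k b f : smooth k 0 b f ->
  smooth k 0 b (fun s => comp_series C al (f s)).
Proof.
move=> sf j s n *; rewrite fdiffn_sum big1 // => i _.
rewrite (fdiffn_morph (h := *%R (C (al i)))); last exact: mulrBr.
suff sp : smooth k 0 b (fun s => conv_pow (f s) i) by rewrite sp ?mulr0.
elim: (i : nat) => [|m IH]; first exact: smooth_cst.
exact: (smooth_conv (p := 0) sf IH).
Qed.

End SmoothSequences.

(** * Division in the step size *)

Section L1Norm.
Variables (R : realType) (D : nat).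
Implicit Types u v : 'rV[R]_D.

Definition l1norm u : R := row_norm (fun x : R => `|x|) u.

Lemma l1norm_ge0 u : 0 <= l1norm u.
Proof. exact: sumr_ge0. Qed.

Lemma l1normD u v : l1norm (u + v) <= l1norm u + l1norm v.
Proof. by rewrite -big_split; apply: ler_sum => c _; rewrite mxE ler_normD. Qed.

Lemma l1normZ a u : l1norm (a *: u) = `|a| * l1norm u.
Proof. by rewrite /l1norm /row_norm mulr_sumr; apply: eq_bigr => c _; rewrite mxE normrM. Qed.

Lemma l1normB u v : l1norm (u - v) <= l1norm u + l1norm v.
Proof. by apply: le_trans (l1normD _ _) _; rewrite -scaleN1r l1normZ normrN1 mul1r. Qed.

Lemma l1norm0 : l1norm 0 = 0.
Proof. by rewrite /l1norm /row_norm big1 // => c _; rewrite mxE normr0. Qed.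

Lemma l1norm_sum (I : Type) (r : seq I) (F : I -> 'rV[R]_D) :
  l1norm (\sum_(i <- r) F i) <= \sum_(i <- r) l1norm (F i).
Proof.
elim/big_ind2: _ => [|x u y v le1 le2|//]; first by rewrite l1norm0.
by apply: le_trans (l1normD _ _) _; rewrite lerD.
Qed.

End L1Norm.

Section Span.
Variables (R : realType) (P : comNzRingType) (C : {rmorphism R -> P}) (T : Type)
  (ev : T -> {rmorphism P -> R}) (eta : T -> R) (D : nat).
Hypothesis eta_gt0 : forall s, 0 < eta s.
Variables (G : nat -> nat -> 'rV[P]_D) (FG : nat -> T -> 'rV[R]_D).
Implicit Types (f : nat -> 'rV[P]_D) (F : T -> 'rV[R]_D).

Definition shift_rows f : nat -> 'rV[P]_D := fun n => if n is n'.+1 then f n' else 0.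

(* The [P[eta]]-linear combinations of [G 0, ..., G (K - 1)], together with the
   functions they represent. *)
Inductive span K : (nat -> 'rV[P]_D) -> (T -> 'rV[R]_D) -> Prop :=
| span_gen k : (k < K)%N -> span K (G k) (FG k)
| span_zero : span K (fun=> 0) (fun=> 0)
| span_add f F f' F' : span K f F -> span K f' F' ->
    span K (fun n => f n + f' n) (fun s => F s + F' s)
| span_scale p f F : span K f F -> span K (fun n => p *: f n) (fun s => ev s p *: F s)
| span_shift f F : span K f F -> span K (shift_rows f) (fun s => eta s *: F s).

Lemma span_mono K K' f F : (K <= K')%N -> span K f F -> span K' f F.
Proof.
move=> le; elim=> *; [apply: span_gen; exact: leq_trans le | exact: span_zero |
  exact: span_add | exact: span_scale | exact: span_shift].
Qed.

Lemma span_lincomb K (I : Type) (r : seq I) (q : I -> P)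
    (f_ : I -> nat -> 'rV[P]_D) (F_ : I -> T -> 'rV[R]_D) :
  (forall i, span K (f_ i) (F_ i)) ->
  span K (fun n => \sum_(i <- r) q i *: f_ i n) (fun s => \sum_(i <- r) ev s (q i) *: F_ i s).
Proof.
move=> H; elim: r => [|i r IH].
  under [X in span K X]funext do rewrite big_nil.
  under [X in span K _ X]funext do rewrite big_nil.
  exact: span_zero.
under [X in span K X]funext do rewrite big_cons.
under [X in span K _ X]funext do rewrite big_cons.
by apply: span_add => //; apply: span_scale.
Qed.

Lemma span_sub K f F f' F' : span K f F -> span K f' F' ->
  span K (fun n => f n - f' n) (fun s => F s - F' s).
Proof.
move=> sf sf'; have := span_add sf (span_scale (-1) sf').
under [X in span K X]funext do rewrite scaleN1r.
by under [X in span K _ X]funext do rewrite rmorphN rmorph1 scaleN1r.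
Qed.

Lemma span_iter_shift K e f F : span K f F ->
  span K (fun n => if (n < e)%N then 0 else f (n - e)%N) (fun s => eta s ^+ e *: F s).
Proof.
move=> sf; elim: e => [|e IH].
  under [X in span K X]funext do rewrite ltn0 subn0.
  by under [X in span K _ X]funext do rewrite expr0 scale1r.
have := span_shift IH.
under [X in span K _ X -> _]funext do rewrite scalerA -exprS.
by congr (span K _ _); apply: funext => -[|n].
Qed.

Variable nu : P -> R.
Hypothesis adm : admissible C ev nu.
Hypothesis FGrep : forall k c,
  represents ev eta nu (fun n => G k n 0 c) (fun s => FG k s 0 c).

Lemma span_combination K f F : span K f F ->
  exists A, 0 <= A /\ forall s, eta s <= 1 -> exists c : nat -> R,
    (forall k, `|c k| <= A) /\ F s = \sum_(k < K) c k *: FG k s.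
Proof.
elim=> [k ltk||f1 F1 f2 F2 _ [A1 [A10 H1]] _ [A2 [A20 H2]]|p f1 F1 _ [A [A0 H]]
  |f1 F1 _ [A [A0 H]]].
- exists 1; split=> // s _; exists (fun j => (j == k)%:R); split.
    by move=> j; case: eqP; rewrite ?normr1 ?normr0.
  rewrite (bigD1 (Ordinal ltk)) //= eqxx scale1r big1 ?addr0 // => j jk.
  by rewrite (_ : (j == k :> nat) = false) ?scale0r //; apply/negbTE.
- exists 0; split=> // s _; exists (fun=> 0); split=> [k|]; first by rewrite normr0.
  by rewrite big1 // => k _; rewrite scale0r.
- exists (A1 + A2); split=> [|s es]; first exact: addr_ge0.
  have [c1 [c1A ->]] := H1 s es; have [c2 [c2A ->]] := H2 s es.
  exists (fun k => c1 k + c2 k); split=> [k|].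
    by apply: le_trans (ler_normD _ _) _; rewrite lerD.
  by rewrite -big_split; apply: eq_bigr => k _; rewrite scalerDl.
- exists (nu p * A); split=> [|s es]; first by rewrite mulr_ge0 ?(nu_ge0 adm).
  have [c [cA ->]] := H s es; exists (fun k => ev s p * c k); split=> [k|].
    by rewrite normrM ler_pM // (nu_ev adm).
  by rewrite scaler_sumr; apply: eq_bigr => k _; rewrite scalerA.
- exists A; split=> // s es.
  have [c [cA ->]] := H s es; exists (fun k => eta s * c k); split=> [k|].
    rewrite normrM gtr0_norm // -[leRHS]mul1r ler_pM //; exact: ltW.
  by rewrite scaler_sumr; apply: eq_bigr => k _; rewrite scalerA.
Qed.

Lemma span_represents K f F : span K f F ->
  forall c, represents ev eta nu (fun n => f n 0 c) (fun s => F s 0 c).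
Proof.
have eqrep a a' H H' : represents ev eta nu a H -> a =1 a' -> H =1 H' ->
  represents ev eta nu a' H' by move=> + /funext <- /funext <-.
elim=> [k _|c|f1 F1 f2 F2 _ H1 _ H2 c|p f1 F1 _ H c|f1 F1 _ H c].
- exact: FGrep.
- apply: eqrep (represents_const adm eta_gt0 0) _ _ => [[|n]|s]; rewrite ?mxE //.
  by rewrite rmorph0.
- by apply: eqrep (represents_add adm eta_gt0 (H1 c) (H2 c)) _ _ => ?; rewrite mxE.
- by apply: eqrep (represents_scale adm p (H c)) _ _ => ?; rewrite mxE.
- by apply: eqrep (represents_shift adm eta_gt0 (H c)) _ _ => [[|n]|s]; rewrite ?mxE.
Qed.

Definition row_psum s f N : 'rV[R]_D := \sum_(j < N) eta s ^+ j *: map_mx (ev s) (f j).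

Definition row_represents B Q f F :=
  [/\ 0 <= B, 1 <= Q, forall j, row_norm nu (f j) <= B * Q ^+ j &
    forall s, Q * eta s <= 1 -> forall N,
      l1norm (F s - row_psum s f N) <= B * (Q * eta s) ^+ N].

Lemma row_psum_lincomb (I : Type) (r : seq I) (q : I -> P)
    (f_ : I -> nat -> 'rV[P]_D) s N :
  row_psum s (fun n => \sum_(i <- r) q i *: f_ i n) N =
  \sum_(i <- r) ev s (q i) *: row_psum s (f_ i) N.
Proof.
under [RHS]eq_bigr do rewrite scaler_sumr.
rewrite exchange_big; apply: eq_bigr => j _.
apply/rowP => c; rewrite !mxE !summxE rmorph_sum mulr_sumr; apply: eq_bigr => i _.
by rewrite !mxE rmorphM mulrCA.
Qed.

Lemma row_psumB f f' s N :
  row_psum s (fun n => f n - f' n) N = row_psum s f N - row_psum s f' N.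
Proof. by rewrite -sumrB; apply: eq_bigr => j _; rewrite map_mxB scalerBr. Qed.

Lemma row_psum_shift e f s N :
  row_psum s (fun n => if (n < e)%N then 0 else f (n - e)%N) (e + N) =
  eta s ^+ e *: row_psum s f N.
Proof.
rewrite /row_psum big_split_ord /= big1 ?add0r => [|i _].
  rewrite scaler_sumr; apply: eq_bigr => i _.
  by rewrite ltnNge leq_addr /= addKn exprD scalerA.
by rewrite ltn_ord map_mx0 scaler0.
Qed.

Lemma row_psum_vanish f s n : (forall j, (j < n)%N -> f j = 0) -> row_psum s f n = 0.
Proof. by move=> f0; rewrite /row_psum big1 // => j _; rewrite f0 // map_mx0 scaler0. Qed.

Lemma span_row_represents K f F : span K f F -> exists B Q, row_represents B Q f F.
Proof.
move=> /span_represents H.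
have /choice[y Hy] c : exists y : R * R,
    represents_with ev eta nu y.1 y.2 (fun n => f n 0 c) (fun s => F s 0 c).
  by have [K' [Q rep]] := H c; exists (K', Q).
have Ky c : 1 <= (y c).1 by case: (Hy c).
have Qy c : 1 <= (y c).2 by case: (Hy c).
have Q0 : 0 <= \sum_c (y c).2 by apply: sumr_ge0 => c _; exact: le_trans (Qy c).
pose Q := 1 + \sum_c (y c).2.
have {}Hy c : represents_with ev eta nu (y c).1 Q (fun n => f n 0 c) (fun s => F s 0 c).
  apply: (represents_weaken eta_gt0 (Hy c)) => //.
  rewrite /Q (bigD1 c) //= addrCA lerDl addr_ge0 // sumr_ge0 // => c' _.
  exact: le_trans (Qy c').
exists (\sum_c (y c).1), Q; split.
- by apply: sumr_ge0 => c _; exact: le_trans (Ky c).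
- by rewrite lerDl.
- by move=> j; rewrite mulr_suml; apply: ler_sum => c _; case: (Hy c).
- move=> s small N; rewrite mulr_suml; apply: ler_sum => c _.
  have [_ _ _ /(_ s small N)] := Hy c; congr (`|_| <= _).
  rewrite !mxE; congr (_ - _); rewrite summxE; apply: eq_bigr => j _.
  by rewrite !mxE mulrC.
Qed.

(** The number [K] of series is existential: these are the lowest coefficients for the span of all
    the [G k]. Finite generation then shows that finitely many [G k] account for them. *)
Definition order_module n (v : 'rV[P]_D) :=
  exists K f F, [/\ span K f F, forall j, (j < n)%N -> f j = 0 & f n = v].

(* [v] is the lowest coefficient of a combination of [G 0, ..., G (m - 1)] whose
   series and coefficients are bounded linearly in terms of [v]. *)
Definition reducible_by kap m B Q A v :=
  exists f F, [/\ span m f F, (forall j, (j < kap)%N -> f j = 0) /\ f kap = v,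
    forall l, row_norm nu (f (kap + l)%N) <= B * row_norm nu v * Q ^+ l,
    forall s, Q * eta s <= 1 -> forall N, l1norm (F s - row_psum s f (kap + N))
       <= B * row_norm nu v * (Q ^+ N * eta s ^+ (kap + N)) &
    forall s, eta s <= 1 -> exists c : nat -> R,
      (forall k, `|c k| <= A * row_norm nu v) /\ F s = \sum_(k < m) c k *: FG k s].


Lemma row_norm_lincomb (I : Type) (r : seq I) (q : I -> P) (v : I -> 'rV[P]_D) :
  row_norm nu (\sum_(i <- r) q i *: v i) <= \sum_(i <- r) nu (q i) * row_norm nu (v i).
Proof.
under [leRHS]eq_bigr do rewrite mulr_sumr.
rewrite exchange_big; apply: ler_sum => c _; rewrite summxE.
apply: le_trans (nu_sum adm _ _ _) _; apply: ler_sum => i _; rewrite mxE.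
exact: nuM adm _ _.
Qed.

Lemma order_module_submodule n : submodule (order_module n).
Proof.
split.
- by exists 0%N, (fun=> 0), (fun=> 0); split=> //; exact: span_zero.
- move=> u v [K [f [F [sf f0 fu]]]] [K' [f' [F' [sf' f0' fv]]]].
  exists (maxn K K'), (fun n => f n + f' n), (fun s => F s + F' s); split.
  + by apply: span_add; [apply: span_mono sf; rewrite leq_maxl |
      apply: span_mono sf'; rewrite leq_maxr].
  + by move=> j jn; rewrite f0 ?f0' ?addr0.
  + by rewrite fu fv.
- move=> p u [K [f [F [sf f0 fu]]]].
  exists K, (fun n => p *: f n), (fun s => ev s p *: F s); split.
  + exact: span_scale.
  + by move=> j jn; rewrite f0 ?scaler0.
  + by rewrite fu.
Qed.

Lemma order_moduleS n v : order_module n v -> order_module n.+1 v.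
Proof.
move=> [K [f [F [sf f0 fv]]]]; exists K, (shift_rows f), (fun s => eta s *: F s).
by split=> //; [exact: span_shift | case=> // j /f0].
Qed.

Lemma reducible_weaken kap m B Q A m' B' Q' A' v :
  (m <= m')%N -> 0 <= B -> 1 <= Q -> B <= B' -> Q <= Q' -> A <= A' ->
  reducible_by kap m B Q A v -> reducible_by kap m' B' Q' A' v.
Proof.
move=> lem B0 Q1 leB leQ leA [f [F [sf fv fB fE fA]]].
have v0 := row_norm_ge0 adm v.
have Q0 : 0 <= Q by exact: le_trans Q1.
have QN N : Q ^+ N <= Q' ^+ N by rewrite lerXn2r ?nnegrE // (le_trans Q0).
exists f, F; split=> //.
- exact: span_mono sf.
- move=> l; apply: le_trans (fB l) _.
  by apply: ler_pM; rewrite ?mulr_ge0 ?exprn_ge0 // ler_wpM2r.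
- move=> s small N; have e0 := ltW (eta_gt0 s).
  apply: le_trans (fE s _ N) _; first by apply: le_trans small; rewrite ler_wpM2r.
  apply: ler_pM; rewrite ?mulr_ge0 ?exprn_ge0 //; first by rewrite ler_wpM2r.
  by rewrite ler_wpM2r ?exprn_ge0.
- move=> s es; have [c [cA ->]] := fA s es.
  exists (fun k => if (k < m)%N then c k else 0); split=> [k|].
    case: ifP => _; first by apply: le_trans (cA k) _; rewrite ler_wpM2r.
    rewrite normr0; apply: le_trans (normr_ge0 (c 0%N)) _.
    by apply: le_trans (cA _) _; rewrite ler_wpM2r.
  rewrite (big_ord_widen_cond m' xpredT (fun k => c k *: FG k s)) // big_mkcond.
  by apply: eq_bigr => k _ /=; case: (k < m)%N; rewrite ?scale0r.
Qed.

(** Each of the finitely many generators is lifted once to a combination of series. Bounded division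
    then lifts every [v], with constants taken from the generators and a factor linear in [v]. *)
Lemma order_module_reducible kap : divides_boundedly nu (order_module kap) ->
  exists m B Q A, [/\ 0 <= B, 1 <= Q, 0 <= A &
    forall v, order_module kap v -> reducible_by kap m B Q A v].
Proof.
move=> [I [g [K0 [K00 gL gen]]]].
have /choice[y Hy] i : exists y : nat * ((nat -> 'rV[P]_D) * (T -> 'rV[R]_D)),
    [/\ span y.1 y.2.1 y.2.2, forall j, (j < kap)%N -> y.2.1 j = 0 & y.2.1 kap = g i].
  by have [K [f [F H]]] := gL i; exists (K, (f, F)).
pose m := \max_i (y i).1; pose f i := (y i).2.1; pose F i := (y i).2.2.
have sp i : span m (f i) (F i).
  by case: (Hy i) => + _ _; apply: span_mono; exact: (leq_bigmax (F := fun i => (y i).1)).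
have /choice[z Hz] i : exists z : R * R, row_represents z.1 z.2 (f i) (F i).
  by have [B [Q H]] := span_row_represents (sp i); exists (B, Q).
have /choice[A HA] i := span_combination (sp i).
have z10 i : 0 <= (z i).1 by case: (Hz i).
have z20 i : 0 <= (z i).2 by case: (Hz i) => _ /(le_trans ler01).
pose Q := 1 + \sum_i (z i).2; pose B := \sum_i (z i).1.
have Q1 : 1 <= Q by rewrite lerDl sumr_ge0.
have Q0 : 0 <= Q by exact: le_trans Q1.
have B0 : 0 <= B by exact: sumr_ge0.
have zQ i : (z i).2 <= Q.
  by rewrite /Q (bigD1 i) //= addrCA lerDl addr_ge0 // sumr_ge0.
have zB i : (z i).1 <= B by rewrite /B (bigD1 i) //= lerDl sumr_ge0.
have A0 i : 0 <= A i by case: (HA i).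
exists m, (K0 * B * Q ^+ kap), Q, (K0 * \sum_i A i); split=> //.
- by rewrite !mulr_ge0 ?exprn_ge0.
- by rewrite mulr_ge0 ?sumr_ge0.
move=> v /gen[q [vE qle]].
exists (fun n => \sum_i q i *: f i n), (fun s => \sum_i ev s (q i) *: F i s); split.
- exact: span_lincomb.
- split=> [j jk|]; first by apply: big1 => i _; case: (Hy i) => _ f0 _; rewrite /f f0 ?scaler0.
  by rewrite vE; apply: eq_bigr => i _; congr (_ *: _); case: (Hy i).
- move=> l; apply: le_trans (row_norm_lincomb _ _ _) _.
  apply: (@le_trans _ _ (\sum_i nu (q i) * (B * Q ^+ (kap + l)))).
    apply: ler_sum => i _; rewrite ler_wpM2l ?(nu_ge0 adm) //.
    have [_ _ fB _] := Hz i; apply: le_trans (fB _) _.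
    by apply: ler_pM; rewrite ?exprn_ge0 // lerXn2r ?nnegrE.
  rewrite -mulr_suml exprD [leRHS](_ : _ = K0 * row_norm nu v * (B * (Q ^+ kap * Q ^+ l))).
    by rewrite ler_wpM2r // !mulr_ge0 ?exprn_ge0.
  by ring.
- move=> s small N; rewrite row_psum_lincomb -sumrB.
  have e0 := ltW (eta_gt0 s).
  apply: le_trans (l1norm_sum _ _) _.
  apply: (@le_trans _ _ (\sum_i nu (q i) * (B * (Q * eta s) ^+ (kap + N)))).
    apply: ler_sum => i _; rewrite -scalerBr l1normZ.
    apply: ler_pM; rewrite ?l1norm_ge0 ?(nu_ev adm) //.
    have [_ _ _ fE] := Hz i.
    have le : (z i).2 * eta s <= Q * eta s by rewrite ler_wpM2r.
    apply: le_trans (fE s _ _) _; first exact: le_trans small.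
    by apply: ler_pM; rewrite ?exprn_ge0 ?mulr_ge0 // lerXn2r ?nnegrE ?mulr_ge0.
  rewrite -mulr_suml exprMn exprD.
  rewrite [leRHS](_ : _ = K0 * row_norm nu v
    * (B * (Q ^+ kap * Q ^+ N * eta s ^+ (kap + N)))); last by ring.
  by rewrite ler_wpM2r // !mulr_ge0 ?exprn_ge0.
- move=> s es.
  have /choice[c Hc] i : exists c : nat -> R,
      (forall k, `|c k| <= A i) /\ F i s = \sum_(k < m) c k *: FG k s.
    by case: (HA i) => _; exact.
  exists (fun k => \sum_i ev s (q i) * c i k); split=> [k|].
    apply: le_trans (ler_norm_sum _ _ _) _.
    apply: (@le_trans _ _ (\sum_i nu (q i) * \sum_i A i)).
      apply: ler_sum => i _; rewrite normrM; apply: ler_pM; rewrite ?(nu_ev adm) //.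
      case: (Hc i) => cA _; apply: le_trans (cA k) _.
      by rewrite (bigD1 i) //= lerDl sumr_ge0.
    by rewrite -mulr_suml mulrAC ler_wpM2r ?sumr_ge0.
  under [RHS]eq_bigr do rewrite scaler_suml.
  rewrite exchange_big; apply: eq_bigr => i _.
  case: (Hc i) => _ ->; rewrite scaler_sumr; apply: eq_bigr => k _.
  by rewrite scalerA.
Qed.

Lemma uniformly_reducible n0 :
  (forall kap, (kap <= n0)%N -> divides_boundedly nu (order_module kap)) ->
  exists m B Q A, [/\ 0 <= B, 1 <= Q, 0 <= A & forall kap v, (kap <= n0)%N ->
    order_module kap v -> reducible_by kap m B Q A v].
Proof.
elim: n0 => [|n0 IH] div.
  have [m [B [Q [A [B0 Q1 A0 H]]]]] := order_module_reducible (div 0%N (leqnn _)).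
  by exists m, B, Q, A; split=> // kap v; rewrite leqn0 => /eqP ->; exact: H.
have [|m [B [Q [A [B0 Q1 A0 H]]]]] := IH; first by move=> kap le; apply: div; lia.
have [m' [B' [Q' [A' [B0' Q1' A0' H']]]]] := order_module_reducible (div _ (leqnn _)).
exists (m + m')%N, (B + B'), (Q + Q'), (A + A'); split; try lra.
move=> kap v; rewrite leq_eqVlt => /predU1P[->|lek] Lv.
  by apply: reducible_weaken (H' _ Lv) => //; [exact: leq_addl | lra..].
by apply: reducible_weaken (H _ _ lek Lv) => //; [exact: leq_addr | lra..].
Qed.

(* The lowest coefficient of the current remainder is cancelled by a bounded
   combination of [G 0, ..., G (m - 1)]; coefficients of the remainder after [n]
   steps grow at most like [Q' ^ n * Q ^ (j - n)], so it tends to [0] when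
   [2 * Q' * eta <= 1]. *)
Lemma division_step n0 m (B Q A : R) M (B0 : R) n g Fg (Q' := Q * (1 + B))
    (A' := A * B0 * (2 * Q') ^+ n0) :
  0 <= B -> 1 <= Q -> 0 <= A -> 0 <= B0 ->
  (forall k v, (n0 <= k)%N -> order_module k v -> order_module n0 v) ->
  (forall kap v, (kap <= n0)%N -> order_module kap v -> reducible_by kap m B Q A v) ->
  (m <= M)%N -> span M g Fg -> (forall j, (j < n)%N -> g j = 0) ->
  (forall j, row_norm nu (g (n + j)%N) <= B0 * Q' ^+ n * Q ^+ j) ->
  (forall s, 2 * Q' * eta s <= 1 -> forall N,
    l1norm (Fg s - row_psum s g (n + N)) <= B0 * Q' ^+ n * (Q ^+ N * eta s ^+ (n + N))) ->
  exists g' Fg', [/\ span M g' Fg', forall j, (j < n.+1)%N -> g' j = 0,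
    forall j, row_norm nu (g' (n.+1 + j)%N) <= B0 * Q' ^+ n.+1 * Q ^+ j,
    forall s, 2 * Q' * eta s <= 1 -> forall N,
      l1norm (Fg' s - row_psum s g' (n.+1 + N))
        <= B0 * Q' ^+ n.+1 * (Q ^+ N * eta s ^+ (n.+1 + N)) &
    forall s, 2 * Q' * eta s <= 1 -> exists c : nat -> R,
      (forall k, `|c k| <= A' / 2 ^+ n) /\ Fg s = Fg' s + \sum_(k < m) c k *: FG k s].
Proof.
move=> B1 Q1 A0 B00 stable red mM sg g0 gB gE.
have Q0 : 0 <= Q by exact: le_trans Q1.
have Q'1 : 1 <= Q' by rewrite /Q'; nra.
have Q'0 : 0 <= Q' by exact: le_trans Q'1.
pose v := g n.
(* Past order [n0] the lowest coefficient is already one of order [n0]; the cancelling series is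
   then multiplied by [eta ^ e]. *)
have [kap [e [en kn0 Lv]]] : exists kap e,
    [/\ (e + kap)%N = n, (kap <= n0)%N & order_module kap v].
  have Ln : order_module n v by exists M, g, Fg.
  exists (minn n n0), (n - minn n n0)%N; split; [|exact: geq_minr|].
    by rewrite subnK // geq_minl.
  by case: (leqP n n0) => // /ltnW le; exact: stable Ln.
have vB : row_norm nu v <= B0 * Q' ^+ n by have := gB 0%N; rewrite addn0 expr0 mulr1.
have v0 : 0 <= row_norm nu v := row_norm_ge0 adm v.
have BQ0 : 0 <= B0 * Q' ^+ n by rewrite mulr_ge0 ?exprn_ge0.
have [f [F [sf [f0 fv] fB fE fA]]] := red _ _ kn0 Lv.
exists (fun j => g j - if (j < e)%N then 0 else f (j - e)%N),
  (fun s => Fg s - eta s ^+ e *: F s).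
have small1 s : 2 * Q' * eta s <= 1 -> Q * eta s <= 1 /\ eta s <= 1.
  move=> small; have e0 := eta_gt0 s.
  have : Q * eta s <= 2 * Q' * eta s.
    by rewrite ler_wpM2r ?(ltW e0) // /Q'; nra.
  have : eta s <= Q * eta s by rewrite ler_peMl // ltW.
  lra.
split.
- by apply: span_sub => //; apply: span_iter_shift; exact: span_mono sf.
- move=> j; rewrite ltnS leq_eqVlt => /predU1P[->|jn].
    by rewrite -en ltnNge leq_addr /= addKn fv en subrr.
  rewrite g0 // sub0r; case: ltnP => [_|je]; rewrite ?oppr0 // f0 ?oppr0 //.
  by rewrite ltn_subLR // en.
- move=> j; rewrite addSnnS.
  have -> : (n + j.+1 = e + (kap + j.+1))%N by rewrite addnA en.
  rewrite ltnNge leq_addr /= addKn.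
  (* The old remainder and the subtracted series add up to a factor [1 + B], and re-indexing by one
     gives a factor [Q]: this is the choice of [Q']. *)
  apply: (@le_trans _ _ (B0 * Q' ^+ n * Q ^+ j.+1 + B * (B0 * Q' ^+ n) * Q ^+ j.+1)).
    apply: (@le_trans _ _ (row_norm nu (g (e + (kap + j.+1))%N) + row_norm nu (f (kap + j.+1)%N))).
      rewrite -big_split; apply: ler_sum => c _; rewrite !mxE; exact: nuB adm _ _.
    rewrite addnA en; apply: lerD (gB _) _; apply: le_trans (fB _) _.
    by rewrite ler_wpM2r ?exprn_ge0 // ler_wpM2l.
  by rewrite exprS [Q' ^+ n.+1]exprS /Q' le_eqVlt; apply/predU1l; ring.
- move=> s small N; rewrite addSnnS.
  have [Qe1 _] := small1 s small; have e0 := ltW (eta_gt0 s).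
  have eN : (n + N.+1 = e + (kap + N.+1))%N by rewrite addnA en.
  rewrite row_psumB [X in _ - (_ - row_psum _ _ X)]eN row_psum_shift.
  rewrite (_ : _ - _ = (Fg s - row_psum s g (n + N.+1))
      - eta s ^+ e *: (F s - row_psum s f (kap + N.+1))); last first.
    by rewrite scalerBr !opprB addrACA [RHS]addrACA; congr (_ + _); exact: addrC.
  apply: le_trans (l1normB _ _) _; rewrite l1normZ normrX gtr0_norm //.
  set t := Q ^+ N.+1 * eta s ^+ (n + N.+1).
  have t0 : 0 <= t by rewrite mulr_ge0 ?exprn_ge0 // ltW.
  apply: (@le_trans _ _ (B0 * Q' ^+ n * t + B * (B0 * Q' ^+ n) * t)).
    apply: lerD (gE s small _) _.
    apply: le_trans (ler_wpM2l _ (fE s Qe1 _)) _; first by rewrite exprn_ge0 // ltW.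
    rewrite mulrCA [X in _ * X]mulrCA -exprD -eN.
    by rewrite ler_wpM2r // ler_wpM2l.
  by rewrite /t exprS [Q' ^+ n.+1]exprS /Q' le_eqVlt; apply/predU1l; ring.
- move=> s small; have [Qe1 e1] := small1 s small; have e0 := eta_gt0 s.
  have [c [cA FE]] := fA s e1.
  exists (fun k => eta s ^+ e * c k); split=> [k|]; last first.
    rewrite FE scaler_sumr; under [X in _ - X]eq_bigr do rewrite scalerA.
    by rewrite subrK.
  rewrite normrM normrX (gtr0_norm e0).
  have BA : `|c k| <= A * (B0 * Q' ^+ n).
    by apply: le_trans (cA k) _; rewrite ler_wpM2l.
  rewrite ler_pdivlMr ?exprn_gt0 //.
  have Qe : (2 * Q' * eta s) ^+ e <= 1.
    apply: exprn_ile1 => //; apply: mulr_ge0; last exact: ltW.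
    exact: mulr_ge0.
  apply: (@le_trans _ _ (eta s ^+ e * (A * (B0 * Q' ^+ n)) * 2 ^+ n)).
    by rewrite ler_wpM2r ?exprn_ge0 // ler_wpM2l ?exprn_ge0 // ltW.
  (* The [e] spare powers of [eta] absorb the growth [Q' ^ n] and the gain [2 ^ n], up to the
     exponent [kap], which is at most [n0]. *)
  rewrite (_ : _ * 2 ^+ n = A * B0 * (2 * Q') ^+ kap * (2 * Q' * eta s) ^+ e); last first.
    by rewrite -en !exprMn !exprD; ring.
  have Q'2 : 0 <= 2 * Q' by exact: mulr_ge0.
  have AB : 0 <= A * B0 by exact: mulr_ge0.
  rewrite -[leRHS]mulr1 /A'; apply: ler_pM => //.
  - by apply: mulr_ge0 => //; exact: exprn_ge0.
  - by apply: exprn_ge0; apply: mulr_ge0 => //; exact: ltW.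
  - by apply: ler_wpM2l => //; apply: ler_weXn2l => //; lra.
Qed.
End Span.

(** * From approximate to exact relations *)

Lemma continuous_sumr (R : realType) (U : topologicalType) (I : Type) (r : seq I)
    (f : I -> U -> R) : (forall i, continuous (f i)) ->
  continuous (fun x => \sum_(i <- r) f i x).
Proof.
move=> cf; elim: r => [|i r IH] x.
  under eq_fun do rewrite big_nil; exact: cvg_cst.
under eq_fun do rewrite big_cons; apply: continuousD; [exact: cf | exact: IH].
Qed.

(** The distance from [w] to the combination attains its minimum on the compact box of scalars, and
    that minimum lies below every [B / 2 ^+ n]. The scalars in the hypothesis may change with
    [n]. *)
Lemma bounded_combination_exact (R : realType) m D (w : 'rV[R]_D) (u : 'I_m -> 'rV[R]_D)
    (A B : R) :
  (forall n, exists c : 'I_m -> R, (forall k, `|c k| <= A) /\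
     l1norm (w - \sum_k c k *: u k) <= B / 2 ^+ n) ->
  exists c : 'I_m -> R, (forall k, `|c k| <= A) /\ w = \sum_k c k *: u k.
Proof.
move=> H.
pose f (c : 'rV[R]_m) := l1norm (w - \sum_k c 0 k *: u k).
pose S : set 'rV[R]_m := [set v : 'rV[R]_m | forall k, `[- A, A]%classic (v ord0 k)]%classic.
have memS (c : 'rV[R]_m) : c \in S <-> forall k, `|c 0 k| <= A.
  rewrite inE; split=> Sc k; have := Sc k; rewrite /= in_itv /= -ler_norml //.
have cS : compact S.
  by apply: (rV_compact (A := fun=> `[- A, A]%classic)) => k; exact: segment_compact.
have approx n : exists c, c \in S /\ f c <= B / 2 ^+ n.
  have [c [cA cB]] := H n; exists (\row_k c k); split.
    by apply/memS => k; rewrite mxE.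
  by rewrite /f; under eq_bigr do rewrite mxE.
have S0 : (S !=set0)%classic by have [c [+ _]] := approx 0%N; rewrite inE; exists c.
have cf : continuous f.
  apply: continuous_sumr => j.
  pose g (c : 'rV[R]_m) := w 0 j - \sum_k c 0 k * u k 0 j.
  have -> : (fun c : 'rV[R]_m => `|(w - \sum_k c 0 k *: u k) 0 j|) = Num.norm \o g.
    apply: funext => c; rewrite /g /= !mxE summxE; congr (`|_ - _|).
    by apply: eq_bigr => k _; rewrite mxE.
  move=> c; apply: continuous_comp; last exact: norm_continuous.
  have sumc : continuous (fun c : 'rV[R]_m => \sum_k c 0 k * u k 0 j).
    apply: continuous_sumr => k c'.
    by apply: continuousM; [exact: coord_continuous | exact: cst_continuous].
  by apply: continuousB; [exact: cst_continuous | exact: sumc].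
have [c cinS cmin] := EVT_min_rV S0 cS (continuous_subspaceT cf).
exists (c 0); split; first exact/memS.
have fc n : f c <= B / 2 ^+ n by have [c' [/cmin + le]] := approx n; move/le_trans; exact.
have fc0 : f c <= 0.
  rewrite leNgt; apply/negP => fp.
  have Bp : 0 < B by have := fc 0%N; rewrite expr0 divr1; exact: lt_le_trans.
  have := fc (Num.bound (B / f c)); rewrite ler_pdivlMr ?exprn_gt0 // mulrC -ler_pdivlMr //.
  apply/negP; rewrite -ltNge; apply: lt_trans (archi_boundP _) _.
    by rewrite divr_ge0 // ltW.
  by rewrite -natrX ltr_nat ltn_expl.
apply/eqP; rewrite -subr_eq0; apply/eqP/rowP => j; rewrite [RHS]mxE.
apply/eqP; rewrite -normr_le0; apply: le_trans fc0.
by rewrite /f /l1norm /row_norm (bigD1 j) //= lerDl sumr_ge0.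
Qed.

Section FiniteRecurrence.
Variables (R : realType) (P : comNzRingType) (C : {rmorphism R -> P}) (T : Type)
  (ev : T -> {rmorphism P -> R}) (eta : T -> R) (D : nat).
Hypothesis eta_gt0 : forall s, 0 < eta s.
Hypothesis bn : bounded_noetherian C ev.
Variables (G : nat -> nat -> 'rV[P]_D) (FG : nat -> T -> 'rV[R]_D).
Hypothesis FGrep : forall nu, admissible C ev nu -> forall k c,
  represents ev eta nu (fun n => G k n 0 c) (fun s => FG k s 0 c).

(** The series needed for reduction are found before the dividend is chosen, so any later one can be
    divided; [G m] with [m = m0.+1] also ensures [1 <= m]. *)
Theorem finite_recurrence : exists m (A eta0 : R),
  [/\ (1 <= m)%N, 0 < eta0 & forall s, eta s <= eta0 -> exists c : 'I_m -> R,
    (forall k, `|c k| <= A) /\ FG m s = \sum_k c k *: FG k s].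
Proof.
have [n0 stable] := chain_stabilizes bn
  (order_module_submodule ev eta G FG) (@order_moduleS _ _ _ ev eta _ G FG).
have [nu [adm div]] := bn (J := 'I_n0.+1)
  (fun kap => order_module_submodule ev eta G FG kap).
have rep := FGrep adm.
have [|m0 [B [Q0 [A [B0 Q01 A0 red0]]]]] :=
  @uniformly_reducible _ _ _ _ _ _ _ eta_gt0 _ _ _ adm rep n0.
  move=> kap; rewrite -ltnS => lt; exact: (div (Ordinal lt)).
pose m := m0.+1.
have sG : span ev eta G FG m.+1 (G m) (FG m) by exact: span_gen.
have [B' [Q' [B0' Q1' GB GE]]] := span_row_represents eta_gt0 adm rep sG.
pose Q := Q0 + Q'.
have Q1 : 1 <= Q by rewrite /Q; lra.
have QQ0 : Q0 <= Q by rewrite /Q; lra.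
have QQ' : Q' <= Q by rewrite /Q; lra.
have red kap v : (kap <= n0)%N -> order_module ev eta G FG kap v ->
    reducible_by ev eta G FG nu kap m B Q A v.
  move=> le Lv; apply: (reducible_weaken eta_gt0 adm) (red0 _ _ le Lv) => //.
pose q := Q * (1 + B).
have q1 : 1 <= q by rewrite /q; nra.
pose A' := A * B' * (2 * q) ^+ n0.
have A'0 : 0 <= A' by rewrite !mulr_ge0 ?exprn_ge0 // !mulr_ge0 //; lra.
have Q0' : 0 <= Q' by lra.
have iter n : exists g Fg, [/\ span ev eta G FG m.+1 g Fg,
    forall j, (j < n)%N -> g j = 0,
    forall j, row_norm nu (g (n + j)%N) <= B' * q ^+ n * Q ^+ j,
    forall s, 2 * q * eta s <= 1 -> forall N,
      l1norm (Fg s - row_psum ev eta s g (n + N))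
        <= B' * q ^+ n * (Q ^+ N * eta s ^+ (n + N)) &
    forall s, 2 * q * eta s <= 1 -> exists c : nat -> R,
      (* The sum of the first [n] step bounds [A' / 2 ^ i], so the scalars stay below [2 * A'] for
         all [n]. *)
      (forall k, `|c k| <= 2 * A' * (1 - (2 ^+ n)^-1)) /\
      FG m s = Fg s + \sum_(k < m) c k *: FG k s].
  elim: n => [|n [g [Fg [sg g0 gB gE gA]]]].
    exists (G m), (FG m); split=> //.
    - move=> j; rewrite add0n expr0 mulr1; apply: le_trans (GB j) _.
      by rewrite ler_wpM2l // lerXn2r ?nnegrE //; lra.
    - move=> s small N; have e0 := eta_gt0 s.
      have le1 : Q' * eta s <= Q * eta s by rewrite ler_wpM2r // ltW.
      have le2 : Q * eta s <= 2 * q * eta s by rewrite ler_wpM2r ?(ltW e0) // /q; nra.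
      rewrite expr0 mulr1 -exprMn; apply: le_trans (GE s _ N) _; first lra.
      by rewrite ler_wpM2l // lerXn2r ?nnegrE ?mulr_ge0 ?(ltW e0) //; lra.
    - move=> s small; exists (fun=> 0); split=> [k|].
        by rewrite normr0 expr0 invr1 subrr mulr0.
      by rewrite big1 ?addr0 // => k _; rewrite scale0r.
  have [g' [Fg' [sg' g0' gB' gE' step]]] := division_step eta_gt0 adm B0 Q1 A0 B0'
    (fun k v => @stable k v) red (leqnSn m) sg g0 gB gE.
  exists g', Fg'; split=> // s small.
  have [c [cA ->]] := gA s small; have [c' [cA' ->]] := step s small.
  exists (fun k => c k + c' k); split=> [k|].
    apply: le_trans (ler_normD _ _) _; apply: le_trans (lerD (cA k) (cA' k)) _.
    rewrite -/q -/A' exprS invfM; set z := (2 ^+ n)^-1.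
    by rewrite le_eqVlt; apply/predU1l; field.
  rewrite -addrA -big_split; congr (_ + _).
  by apply: eq_bigr => k _; rewrite scalerDl addrC.
exists m, (2 * A'), (2 * q)^-1; split=> // [|s small]; first by rewrite invr_gt0; lra.
have e0 := eta_gt0 s.
have small' : 2 * q * eta s <= 1 by rewrite mulrC -ler_pdivlMr ?div1r //; lra.
apply: (bounded_combination_exact (B := B')) => n.
have [g [Fg [sg g0 gB gE gA]]] := iter n.
have [c [cA E]] := gA s small'; exists (fun k => c k); split=> [k|].
  have z0 : 0 <= (2 ^+ n)^-1 :> R by rewrite invr_ge0 exprn_ge0.
  have A2 : 0 <= 2 * A' by exact: mulr_ge0.
  by apply: le_trans (cA k) _; rewrite -[leRHS]mulr1 (ler_wpM2l A2) // lerBlDr lerDl.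
rewrite E addrK; have := gE s small' 0%N.
rewrite addn0 row_psum_vanish // subr0 expr0 mul1r => /le_trans; apply.
rewrite -mulrA -exprMn -exprVn; apply: ler_wpM2l => //.
(* The remainder after [n] steps is at most [B' * (q * eta s) ^ n], which the choice of [eta0] turns
   into [B' / 2 ^ n]. *)
have qe : q * eta s <= 2^-1 by rewrite -[leRHS]mul1r ler_pdivlMr //; lra.
apply: lerXn2r => //; rewrite nnegrE ?invr_ge0 //.
by apply: mulr_ge0; [lra | exact: ltW].
Qed.

End FiniteRecurrence.

(** * Optimistic Hedge over a window of times *)

Section ElementarySeries.
Variable R : realType.

(** The remainder is exactly [(- v) ^+ N / (1 + v)], and [1 + v] is at least one half. *)
Lemma geometric_remainder (v : R) N : `|v| <= 2^-1 ->
  `|(1 + v)^-1 - \sum_(i < N) (-1) ^+ i * v ^+ i| <= 2 * `|v| ^+ N.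
Proof.
move=> v2; have v1 : 2^-1 <= 1 + v by move: v2; rewrite ler_norml => /andP[]; lra.
have vp : 0 < 1 + v by lra.
have -> : \sum_(i < N) (-1) ^+ i * v ^+ i = (1 - (- v) ^+ N) / (1 + v).
  apply: (@mulIf _ (1 + v)); first by rewrite gt_eqF.
  rewrite divfK ?gt_eqF //; elim: N => [|N IH]; first by rewrite big_ord0 mul0r subrr.
  by rewrite big_ord_recr mulrDl IH /= -exprMn mulN1r exprS; ring.
rewrite -[X in `|X - _|]mul1r -mulrBl subKr normrM normrX normrN mulrC.
rewrite ler_wpM2r ?exprn_ge0 // gtr0_norm ?invr_gt0 //.
by rewrite -[leRHS]invrK lef_pV2 ?posrE ?invr_gt0.
Qed.

Lemma expR_remainder (v : R) N : `|v| <= 2^-1 ->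
  `|expR v - \sum_(i < N) v ^+ i / i`!%:R| <= 2 * `|v| ^+ N.
Proof.
move=> v2.
(* The finite tails are dominated by a geometric series of ratio one half; the bound then passes to
   the limit defining [expR]. *)
have tail M : `|\sum_(i < N + M) v ^+ i / i`!%:R - \sum_(i < N) v ^+ i / i`!%:R|
    <= 2 * `|v| ^+ N * (1 - 2^-1 ^+ M).
  elim: M => [|M IH]; first by rewrite addn0 subrr normr0 expr0 subrr mulr0.
  rewrite addnS big_ord_recr addrAC; apply: le_trans (ler_normD _ _) _.
  apply: le_trans (lerD IH (lexx _)) _.
  have -> : 2 * `|v| ^+ N * (1 - 2^-1 ^+ M.+1)
      = 2 * `|v| ^+ N * (1 - 2^-1 ^+ M) + `|v| ^+ N * 2^-1 ^+ M.
    by rewrite exprS; field.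
  rewrite lerD2l /= normrM normrX exprD -mulrA ler_wpM2l ?exprn_ge0 //.
  rewrite -[leRHS]mulr1; apply: ler_pM; rewrite ?exprn_ge0 //.
    by rewrite lerXn2r ?nnegrE ?invr_ge0.
  by rewrite normfV normr_nat invf_le1 ?ltr0n ?fact_gt0 // ler1n fact_gt0.
have bound M : (N <= M)%N ->
    `|series (exp_coeff v) M - \sum_(i < N) v ^+ i / i`!%:R| <= 2 * `|v| ^+ N.
  move=> /subnKC <-; rewrite /series /= big_mkord; apply: le_trans (tail _) _.
  have z0 : 0 <= 2^-1 ^+ (M - N) :> R by rewrite exprn_ge0 ?invr_ge0.
  rewrite -[leRHS]mulr1 ler_wpM2l ?mulr_ge0 ?exprn_ge0 //.
  by rewrite lerBlDr lerDl.
have cv := is_cvg_series_exp_coeff v.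
rewrite ler_distl; apply/andP; split.
  rewrite /expR; apply: limr_ge cv _; exists N => // M /= le.
  by have := bound M le; rewrite ler_distl => /andP[].
rewrite /expR; apply: limr_le cv _; exists N => // M /= le.
by have := bound M le; rewrite ler_distl => /andP[].
Qed.

Lemma expRN_remainder (v : R) N : `|v| <= 2^-1 ->
  `|expR (- v) - \sum_(i < N) ((-1) ^+ i / i`!%:R) * v ^+ i| <= 2 * `|v| ^+ N.
Proof.
move=> v2; have := @expR_remainder (- v) N; rewrite normrN => /(_ v2).
congr (`|_ - _| <= _); apply: eq_bigr => i _.
by rewrite [(- v) ^+ i]exprNn mulrAC.
Qed.

End ElementarySeries.

(** Strategies along a window have the shape [x * (g * g) * z], so the root of a product of two
    leaves only [x * y], the values at the start, under a root. *)
Lemma sqrt_weights (R : realType) (x y g h z : R) :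
  0 <= x -> 0 <= y -> 0 <= g -> 0 <= h -> 0 <= z ->
  Num.sqrt (x * (g * g) * z * (y * (h * h) * z)) = Num.sqrt (x * y) * (g * (h * z)).
Proof.
move=> x0 y0 g0 h0 z0.
rewrite (_ : _ * _ = (x * y) * (g * (h * z)) ^+ 2); last by ring.
by rewrite sqrtrM ?mulr_ge0 // sqrtr_sqr ger0_norm ?mulr_ge0.
Qed.

(** * Closed form of the iterates along a window *)

Section Dynamics.
Variables (R : realType) (n : nat) (d : 'I_n -> nat).
Hypothesis hd : forall j, (1 <= d j)%N.
Variables (ell : loss_table R d) (eta : R).
Hypothesis ell01 : unit_valued ell.

Definition mixed_profile (x : vec_profile R d) :=
  forall j, (forall a, 0 < x j a) /\ \sum_a x j a = 1.

Lemma oh_update_mixed x l l' : mixed_profile x -> mixed_profile (oh_update eta x l l').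
Proof.
move=> mx j; have [x0 x1] := mx j.
have w0 b : 0 < oh_weight eta x l l' (j := j) b by rewrite mulr_gt0 ?expR_gt0.
have s0 : 0 < \sum_(b < d j) oh_weight eta x l l' b.
  rewrite (bigD1 (Ordinal (hd j))) //= ltr_pwDl //.
  by apply: sumr_ge0 => b _; exact: ltW.
split=> [a|]; first by rewrite divr_gt0.
by rewrite -mulr_suml divff // gt_eqF.
Qed.

Lemma oh_state_mixed u : mixed_profile (oh_state ell eta u).1.
Proof.
elim: u => [|u IH] /=; last by case: oh_state IH => x l /= IH; exact: oh_update_mixed.
move=> j; split=> [a|]; first by rewrite invr_gt0 ltr0n.
by rewrite sumr_const card_ord -[LHS]mulr_natl divff // pnatr_eq0 -lt0n hd.
Qed.

Lemma mixed_le1 (x : vec_profile R d) j a : mixed_profile x -> `|x j a| <= 1.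
Proof.
move=> /(_ j)[x0 <-]; rewrite gtr0_norm // (bigD1 a) //= lerDl.
by apply: sumr_ge0 => b _; exact: ltW.
Qed.

(** A crude count of action profiles: any bound depending on [d] alone is enough. *)
Lemma expected_loss_bound (x : vec_profile R d) j (a : 'I_(d j)) : mixed_profile x ->
  `|expected_loss ell x a| <= #|{: action_profile d}|%:R :> R.
Proof.
move=> mx; apply: le_trans (ler_norm_sum _ _ _) _.
apply: (@le_trans _ _ (\sum_(p : action_profile d | p j == a) 1)).
  apply: ler_sum => p _; rewrite normrM -[leRHS]mulr1; apply: ler_pM => //.
    by have /andP[p0 p1] := ell01 p j; rewrite ger0_norm.
  rewrite normr_prod; apply: prodr_ile1 => k _.
  by rewrite normr_ge0 mixed_le1.
by rewrite sumr_const ler_nat max_card.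
Qed.

Lemma oh_loss_bound u j (a : 'I_(d j)) :
  `|oh_loss ell eta u a| <= #|{: action_profile d}|%:R :> R.
Proof.
case: u => [|u]; first by rewrite /oh_loss /= /zero_profile normr0.
rewrite oh_lossE //; apply: (@expected_loss_bound _ j a); exact: oh_state_mixed.
Qed.

Variable u : nat.

Definition loss_seq s := oh_loss ell eta (u + s).
Definition strategy_seq s := (oh_state ell eta (u + s)).1.

Lemma loss_seqS s : loss_seq s.+1 = expected_loss ell (strategy_seq s).
Proof. by rewrite /loss_seq addnS oh_lossE. Qed.

Lemma strategy_seqS s :
  strategy_seq s.+1 = oh_update eta (strategy_seq s) (loss_seq s.+1) (loss_seq s).
Proof.
rewrite /strategy_seq /loss_seq !addnS.
by rewrite -[LHS]/(oh_strategy ell eta (u + s).+2) oh_strategyS.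
Qed.

(* Half of the exponent accumulated over [s] steps, so that no square root is
   needed in [loss_gapE]. *)
Fixpoint half_exponent s : vec_profile R d := fun j a =>
  if s is s'.+1 then
    half_exponent s' a + eta * (loss_seq s a - 2^-1 * loss_seq s' a)
  else 0.

Definition half_weight s : vec_profile R d := fun j a => expR (- half_exponent s a).

Lemma strategy_seq_gt0 s j (a : 'I_(d j)) : 0 < strategy_seq s a.
Proof. by have [+ _] := oh_state_mixed (u + s) j; exact. Qed.

Lemma half_weight_gt0 s j (a : 'I_(d j)) : 0 < half_weight s a.
Proof. exact: expR_gt0. Qed.

(** The normalizing sum minus 1, so that its series has no constant term and can be substituted into
    [(1 + v)^-1]. *)
Definition normalizer s j : R :=
  \sum_(b < d j) strategy_seq 0 b * (half_weight s b * half_weight s b - 1).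

Lemma normalizerE s j :
  1 + normalizer s j = \sum_(b < d j) strategy_seq 0 b * (half_weight s b * half_weight s b).
Proof.
rewrite /normalizer; under eq_bigr do rewrite mulrBr mulr1.
rewrite sumrB; have [_ ->] := oh_state_mixed (u + 0) j.
by rewrite addrC subrK.
Qed.

Lemma normalizer_gt0 s j : 0 < 1 + normalizer s j.
Proof.
have pos (b : 'I_(d j)) : 0 < strategy_seq 0 b * (half_weight s b * half_weight s b) :> R.
  by rewrite !mulr_gt0 ?half_weight_gt0 ?strategy_seq_gt0.
rewrite normalizerE (bigD1 (Ordinal (hd j))) //= ltr_pwDl //.
by apply: sumr_ge0 => b _; exact: ltW.
Qed.

(** Successive normalizations cancel, and the update exponent [2 * l - lprev] is twice the increment
    of [half_exponent]; hence a square of half weights. *)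
Lemma strategy_seqE s j (a : 'I_(d j)) : strategy_seq s a =
  strategy_seq 0 a * (half_weight s a * half_weight s a) * (1 + normalizer s j)^-1.
Proof.
elim: s j a => [|s IH] j a.
  have w (b : 'I_(d j)) : half_weight 0 b = 1 :> R by rewrite /half_weight oppr0 expR0.
  rewrite normalizerE; under eq_bigr do rewrite !w !mulr1.
  by have [_ ->] := oh_state_mixed (u + 0) j; rewrite !w invr1 !mulr1.
rewrite strategy_seqS /oh_update.
have E (b : 'I_(d j)) : oh_weight eta (strategy_seq s) (loss_seq s.+1) (loss_seq s) b =
    strategy_seq 0 b * (half_weight s.+1 b * half_weight s.+1 b) / (1 + normalizer s j).
  pose w := expR (- (eta * (loss_seq s.+1 b - 2^-1 * loss_seq s b))).
  have -> : half_weight s.+1 b = half_weight s b * w.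
    by rewrite /half_weight /w -expRD /= opprD.
  rewrite /oh_weight IH (_ : expR _ = w * w).
    by move: w (half_weight s b) (strategy_seq 0 b) (_^-1) => w h x z; ring.
  rewrite /w -expRD; congr expR.
  by move: (loss_seq s.+1 b) (loss_seq s b) => p q; field.
rewrite E; under eq_bigr do rewrite E.
rewrite -mulr_suml -normalizerE.
have := normalizer_gt0 s j; have := normalizer_gt0 s.+1 j.
move: (strategy_seq 0 a) (half_weight s.+1 a) => x h.
move: (1 + normalizer s.+1 j) (1 + normalizer s j) => z' z z0' z0.
by field; rewrite !gt_eqF.
Qed.

Definition reduced_gap s j (a b : 'I_(d j)) : R :=
  half_weight s a * half_weight s b *
  ((1 + normalizer s j)^-1 * (loss_seq s a - loss_seq s b)).

Lemma loss_gapE i s (p : action_pair (d i)) :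
  loss_gap ell eta i (u.+1 + s) p =
  Num.sqrt (strategy_seq 0 (val p).1 * strategy_seq 0 (val p).2)
  * reduced_gap s (val p).1 (val p).2.
Proof.
rewrite ffunE; case: p => -[a b] /= _.
have x0 c : 0 <= strategy_seq 0 c :> R by rewrite ltW // strategy_seq_gt0.
have w0 c : 0 <= half_weight s c :> R by rewrite ltW // half_weight_gt0.
have z0 := normalizer_gt0 s i.
(* Time [u.+1 + s] reads the state at [u + s], which stores the strategy of that time with the loss
   of the time before, exactly the two that the gap combines. *)
change (Num.sqrt (strategy_seq s a * strategy_seq s b)
  * (loss_seq s a - loss_seq s b) =
  Num.sqrt (strategy_seq 0 a * strategy_seq 0 b) * reduced_gap s a b).
rewrite (strategy_seqE s a) (strategy_seqE s b) /reduced_gap.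
have zi : 0 <= (1 + normalizer s i)^-1 by rewrite invr_ge0 ltW.
rewrite sqrt_weights // [(half_weight s a * _) * _]mulrA [RHS]mulrA.
by rewrite -[(half_weight s a * _) * _]mulrA.
Qed.

End Dynamics.

(** * The same dynamics for formal power series in the step size *)

Section FormalDynamics.
Variables (R : realType) (n : nat) (d : 'I_n -> nat).
Variables (P : comNzRingType) (C : {rmorphism R -> P}).
Variables (XL : action_profile d -> 'I_n -> P) (Xx Xg : forall j, 'I_(d j) -> P).

Definition series_profile := forall j : 'I_n, 'I_(d j) -> nat -> P.

Definition exp_coef (i : nat) : R := (-1) ^+ i / i`!%:R.
Definition geo_coef (i : nat) : R := (-1) ^+ i.

Definition weight_series (V : series_profile) : series_profile :=
  fun j a => comp_series C exp_coef (V j a).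

Definition normalizer_series (V : series_profile) j : nat -> P := fun t =>
  \sum_(b < d j) Xx b * (conv (weight_series V b) (weight_series V b) t - const_series 1 t).

Definition inverse_series (V : series_profile) j : nat -> P :=
  comp_series C geo_coef (normalizer_series V j).

Definition strategy_series (V : series_profile) : series_profile := fun j a =>
  conv (fun t => Xx a * conv (weight_series V a) (weight_series V a) t) (inverse_series V j).

Definition loss_series (X : series_profile) : series_profile := fun j a t =>
  \sum_(p : action_profile d | p j == a)
    XL p j * (\big[@conv P/const_series 1]_(k < n | k != j) X k (p k)) t.

(** The formal half exponent and loss. The initial loss is the variable [Xg], so windows starting at
    [t = 1], where the previous loss is zero by convention, need no separate case. *)
Fixpoint state_series (s : nat) : series_profile * series_profile :=
  if s is s'.+1 then
    let: (V, L) := state_series s' in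
    let L' := loss_series (strategy_series V) in
    (fun j a t => V j a t + shift_series (fun t => L' j a t - C 2^-1 * L j a t) t, L')
  else (fun _ _ _ => 0, fun j a => const_series (Xg a)).

Definition exponent_series s := (state_series s).1.
Definition loss_seq_series s := (state_series s).2.

Lemma loss_seq_seriesS s :
  loss_seq_series s.+1 = loss_series (strategy_series (exponent_series s)).
Proof. by rewrite /loss_seq_series /exponent_series /=; case: state_series. Qed.

Lemma exponent_seriesS s j (a : 'I_(d j)) t : exponent_series s.+1 a t =
  exponent_series s a t + shift_series (fun t =>
    loss_seq_series s.+1 a t - C 2^-1 * loss_seq_series s a t) t.
Proof. by rewrite /loss_seq_series /exponent_series /=; case: state_series. Qed.

Definition gap_series s j (a b : 'I_(d j)) : nat -> P :=
  conv (conv (weight_series (exponent_series s) a) (weight_series (exponent_series s) b))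
    (conv (inverse_series (exponent_series s) j)
      (fun t => loss_seq_series s a t - loss_seq_series s b t)).

Lemma exponent_series0 s j (a : 'I_(d j)) : exponent_series s a 0%N = 0.
Proof. by elim: s => // s IH; rewrite exponent_seriesS IH addr0. Qed.

Lemma normalizer_series0 V j : (forall b : 'I_(d j), V j b 0%N = 0) ->
  normalizer_series V j 0%N = 0.
Proof.
move=> V0; rewrite /normalizer_series big1 // => b _.
suff w0 : weight_series V b 0%N = 1 by rewrite /conv big_ord1 !w0 mulr1 subrr mulr0.
by rewrite /weight_series /comp_series big_ord1 /exp_coef expr0 divr1 rmorph1 mulr1.
Qed.

Section Smoothness.
Variables (k b : nat) (V : nat -> series_profile).
Hypothesis sV : forall j (a : 'I_(d j)), smooth k 0 b (fun s => V s a).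

Lemma smooth_weight j (a : 'I_(d j)) : smooth k 0 b (fun s => weight_series (V s) a).
Proof. exact: smooth_comp. Qed.

Lemma smooth_inverse j : smooth k 0 b (fun s => inverse_series (V s) j).
Proof.
apply: smooth_comp; rewrite /normalizer_series; apply: smooth_sum => c; apply: smooth_scale.
apply: smooth_sub; last exact: smooth_cst.
exact: (smooth_conv (p := 0) (q := 0) (smooth_weight c) (smooth_weight c)).
Qed.

Lemma smooth_loss j (a : 'I_(d j)) :
  smooth k 0 b (fun s => loss_series (strategy_series (V s)) a).
Proof.
rewrite /loss_series; apply: smooth_sum => p; apply: smooth_scale; apply: smooth_prod => i.
apply: (smooth_conv (p := 0) (q := 0)); last exact: smooth_inverse.
apply: smooth_scale.
exact: (smooth_conv (p := 0) (q := 0) (smooth_weight (p i)) (smooth_weight (p i))).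
Qed.

End Smoothness.

(** A bootstrap: increments of the exponent are [eta] times losses, so smoothness of the losses to
    order [k] gives the exponents order [k.+1], and the next losses are functions of the exponents.
    The index 1 records the delay: the loss at [s = 0] is a free variable, so differences of order
    [j] are controlled from [s = j] on. *)
Lemma smooth_loss_seq_series k j (a : 'I_(d j)) :
  smooth k 0 1 (fun s => loss_seq_series s a).
Proof.
elim: k j a => [|k IH] j a; first by move=> [|i] s t.
have sV i (c : 'I_(d i)) : smooth k.+1 0 0 (fun s => exponent_series s c).
  apply: smooth_integrate.
  have -> : (fun s t => exponent_series s.+1 c t - exponent_series s c t) =
     (fun s => shift_series (fun t => loss_seq_series s.+1 c t - C 2^-1 * loss_seq_series s c t)).
    by apply: funext => s; apply: funext => t; rewrite exponent_seriesS addrC addKr.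
  apply: smooth_shift; apply: smooth_sub; last exact: smooth_scale.
  by apply: (smooth_weaken (k := k) (p := 0) (b := 0)) (smooth_succ (IH _ _)).
have sL := smooth_loss sV a.
(* Order 0 claims nothing; in the other cases [s] is positive and the loss comes from the preceding
   exponent. *)
move=> [|i] [|s] t lei les ltt //; first lia.
rewrite -(fdiffn_shift i.+1 (fun s => loss_seq_series s a t)).
under [X in fdiffn _ X]funext do rewrite loss_seq_seriesS.
by apply: sL => //; lia.
Qed.

Lemma smooth_exponent_series k j (a : 'I_(d j)) :
  smooth k 0 0 (fun s => exponent_series s a).
Proof.
apply: (@smooth_weaken _ k.+1 0 0 k 0 0) => //; apply: smooth_integrate.
have -> : (fun s t => exponent_series s.+1 a t - exponent_series s a t) =
   (fun s => shift_series (fun t => loss_seq_series s.+1 a t - C 2^-1 * loss_seq_series s a t)).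
  by apply: funext => s; apply: funext => t; rewrite exponent_seriesS addrC addKr.
have sL := @smooth_loss_seq_series k j a.
apply: smooth_shift; apply: smooth_sub; last exact: smooth_scale.
by apply: (smooth_weaken (k := k) (p := 0) (b := 0)) (smooth_succ sL).
Qed.

Lemma smooth_gap_series k j (a b : 'I_(d j)) :
  smooth k 0 1 (fun s => gap_series s a b).
Proof.
have sV i (c : 'I_(d i)) : smooth k 0 1 (fun s => exponent_series s c).
  exact: (smooth_weaken (k := k) (p := 0) (b := 0)) (@smooth_exponent_series k i c).
apply: (smooth_conv (p := 0) (q := 0)).
  exact: (smooth_conv (p := 0) (q := 0) (smooth_weight sV a) (smooth_weight sV b)).
apply: (smooth_conv (p := 0) (q := 0)); first exact: smooth_inverse.
by apply: smooth_sub; exact: smooth_loss_seq_series.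
Qed.

End FormalDynamics.

(** * The series represent the actual iterates *)

Section Scenarios.
Variables (R : realType) (n : nat) (d : 'I_n -> nat).
Hypothesis hd : forall j, (1 <= d j)%N.

(** The parameter over which all constants are uniform: a game, a step size and a window. A window
    starting at time [t] has [sc_time] equal to [t.-1]. *)
Record scenario := Scenario {
  sc_table : loss_table R d;
  sc_step : R;
  sc_time : nat;
  sc_unit : unit_valued sc_table;
  sc_step_gt0 : 0 < sc_step }.

Variables (P : comNzRingType) (C : {rmorphism R -> P}) (ev : scenario -> {rmorphism P -> R}).
Variables (XL : action_profile d -> 'I_n -> P) (Xx Xg : forall j, 'I_(d j) -> P).
Let u := sc_time.
Hypothesis evC : forall th c, ev th (C c) = c.
Hypothesis ev_table : forall th p j, ev th (XL p j) = sc_table th p j.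
Hypothesis ev_strategy : forall th j (a : 'I_(d j)),
  ev th (Xx a) = strategy_seq (sc_table th) (sc_step th) (u th) 0 a.
Hypothesis ev_loss : forall th j (a : 'I_(d j)),
  ev th (Xg a) = loss_seq (sc_table th) (sc_step th) (u th) 0 a.

Definition sc_loss s j (a : 'I_(d j)) th :=
  loss_seq (sc_table th) (sc_step th) (u th) s a.
Definition sc_exponent s j (a : 'I_(d j)) th :=
  half_exponent (sc_table th) (sc_step th) (u th) s a.
Definition sc_gap s j (a b : 'I_(d j)) th :=
  reduced_gap (sc_table th) (sc_step th) (u th) s a b.

Local Notation exponent_series := (exponent_series C XL Xx Xg).
Local Notation loss_seq_series := (loss_seq_series C XL Xx Xg).
Local Notation gap_series := (gap_series C XL Xx Xg).

Section Norm.
Variable nu : P -> R.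
Hypothesis adm : admissible C ev nu.
Local Notation rep := (represents ev sc_step nu).

Lemma exp_coef_le1 i : `|exp_coef R i| <= 1.
Proof.
rewrite /exp_coef normrM normrX normrN1 expr1n mul1r normfV normr_nat.
by rewrite invf_le1 ?ltr0n ?fact_gt0 // ler1n fact_gt0.
Qed.

Lemma geo_coef_le1 i : `|geo_coef R i| <= 1.
Proof. by rewrite /geo_coef normrX normrN1 expr1n. Qed.

Section Step.
Variables (V : series_profile d P) (W : forall j, 'I_(d j) -> scenario -> R).
Hypothesis V0 : forall j (a : 'I_(d j)), V a 0%N = 0.
Hypothesis repV : forall j (a : 'I_(d j)), rep (V a) (W a).

Lemma represents_weight j (a : 'I_(d j)) :
  rep (weight_series C V a) (fun th => expR (- W a th)).
Proof.
exact: (represents_comp adm evC sc_step_gt0 exp_coef_le1 (phi := fun v => expR (- v))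
  (fun v small N => @expRN_remainder R v N small) (repV a) (V0 a)).
Qed.

Lemma represents_inverse j :
  rep (inverse_series C Xx V j)
    (fun th => (1 + \sum_(b < d j) strategy_seq (sc_table th) (sc_step th) (u th) 0 b
       * (expR (- W b th) * expR (- W b th) - 1))^-1).
Proof.
apply: (represents_comp adm evC sc_step_gt0 geo_coef_le1
  (phi := fun v => (1 + v)^-1) (fun v small N => @geometric_remainder R v N small)); last first.
  by apply: normalizer_series0 => b; exact: V0.
have H (b : 'I_(d j)) : rep
    (fun t => Xx b * (conv (weight_series C V b) (weight_series C V b) t - const_series 1 t))
    (fun th => strategy_seq (sc_table th) (sc_step th) (u th) 0 b
       * (expR (- W b th) * expR (- W b th) - 1)).
  apply: represents_ext (represents_scale adm (Xx b) (represents_sub adm sc_step_gt0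
    (represents_conv adm sc_step_gt0 (represents_weight b) (represents_weight b))
    (represents_const adm sc_step_gt0 1))) => th.
  by rewrite ev_strategy rmorph1.
exact: (represents_sum adm sc_step_gt0 _ _ H).
Qed.
End Step.

Lemma represents_state s :
  (forall j (a : 'I_(d j)), rep (exponent_series s a) (sc_exponent s a)) /\
  (forall j (a : 'I_(d j)), rep (loss_seq_series s a) (sc_loss s a)).
Proof.
elim: s => [|s [IHV IHL]].
  split=> j a.
    have := represents_const adm sc_step_gt0 0.
    have -> : const_series (0 : P) = exponent_series 0 a by apply: funext => -[|t].
    by apply: represents_ext => th; rewrite rmorph0.
  by apply: represents_ext (represents_const adm sc_step_gt0 (Xg a)) => th; exact: ev_loss.
have V0 j (a : 'I_(d j)) := exponent_series0 C XL Xx Xg s a.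
have repL j (a : 'I_(d j)) : rep (loss_seq_series s.+1 a) (sc_loss s.+1 a).
  rewrite loss_seq_seriesS.
  pose X j (a : 'I_(d j)) th := strategy_seq (sc_table th) (sc_step th) (u th) s a.
  have repX i (c : 'I_(d i)) :
      rep (strategy_series C Xx (exponent_series s) c) (X i c).
    have rw := represents_weight V0 IHV c.
    apply: represents_ext (represents_conv adm sc_step_gt0
      (represents_scale adm (Xx c) (represents_conv adm sc_step_gt0 rw rw))
      (represents_inverse V0 IHV i)) => th.
    by rewrite ev_strategy /X [RHS](strategy_seqE hd).
  apply: represents_ext (represents_sum adm sc_step_gt0 _ _ (fun p =>
    represents_scale adm (XL p j) (represents_prod adm sc_step_gt0 _ _
      (fun k => repX k (p k))))) => th.
  rewrite /sc_loss loss_seqS; apply: eq_bigr => p _.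
  by rewrite ev_table.
split=> // j a.
have -> : exponent_series s.+1 a = fun t => exponent_series s a t + shift_series (fun t =>
    loss_seq_series s.+1 a t - C 2^-1 * loss_seq_series s a t) t.
  by apply: funext => t; rewrite exponent_seriesS.
apply: represents_ext (represents_add adm sc_step_gt0 (IHV j a)
  (represents_shift adm sc_step_gt0 (represents_sub adm sc_step_gt0 (repL j a)
    (represents_scale adm (C 2^-1) (IHL j a))))) => th.
by rewrite evC.
Qed.

Lemma represents_gap s j (a b : 'I_(d j)) : rep (gap_series s a b) (sc_gap s a b).
Proof.
have [repV repL] := represents_state s.
have V0 i (c : 'I_(d i)) := exponent_series0 C XL Xx Xg s c.
exact: (represents_conv adm sc_step_gt0
  (represents_conv adm sc_step_gt0 (represents_weight V0 repV a) (represents_weight V0 repV b))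
  (represents_conv adm sc_step_gt0 (represents_inverse V0 repV j)
    (represents_sub adm sc_step_gt0 (repL j a) (repL j b)))).
Qed.

Lemma represents_fdiffn k s (f : nat -> nat -> P) (F : nat -> scenario -> R) :
  (forall s, rep (f s) (F s)) ->
  rep (fun t => fdiffn k (f^~ t) s) (fun th => fdiffn k (F^~ th) s).
Proof.
move=> H; elim: k s => // k IH s.
exact: (represents_sub adm sc_step_gt0 (IH s.+1) (IH s)).
Qed.

End Norm.

Variable i : 'I_n.
Let D := #|{: action_pair (d i)}|.
Let pair (c : 'I_D) := val (enum_val c : action_pair (d i)).

(** The series called G_k in the overview. The offset [k] in the degree divides out [eta ^ k], and
    [s = k] is the first place where [smooth_gap_series] allows this. *)
Definition gap_coef k t : 'rV[P]_D :=
  \row_c fdiffn k (fun s => gap_series s (pair c).1 (pair c).2 (k + t)%N) k.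

Definition gap_quotient k th : 'rV[R]_D :=
  \row_c (fdiffn k (fun s => sc_gap s (pair c).1 (pair c).2 th) k / sc_step th ^+ k).

Lemma represents_gap_quotient nu : admissible C ev nu -> forall k c,
  represents ev sc_step nu (fun t => gap_coef k t 0 c) (fun th => gap_quotient k th 0 c).
Proof.
move=> adm k c.
have := represents_unshift sc_step_gt0 (k := k) (represents_fdiffn adm k k
  (fun s => represents_gap adm s (pair c).1 (pair c).2)).
move=> H; apply: represents_ext (_ : represents ev sc_step nu _ _).
  by move=> th; rewrite mxE.
have -> : (fun t => gap_coef k t 0 c) =
    fun t => fdiffn k (fun s => gap_series s (pair c).1 (pair c).2 (k + t)%N) k.
  by apply: funext => t; rewrite mxE.
apply: H => t tk.
have sg := @smooth_gap_series R n d P C XL Xx Xg k i (pair c).1 (pair c).2.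
by apply: sg; rewrite ?addn1.
Qed.

Lemma fdiffn_ffun (I : finType) (k t : nat) (y : nat -> {ffun I -> R^o}) p :
  fdiffn k y t p = fdiffn k (fun s => y s p) t.
Proof. by elim: k t => // k IH t; rewrite !fdiffnS !ffunE !IH. Qed.

Lemma fdiffn_addl (V : zmodType) k t s (y : nat -> V) :
  fdiffn k (fun r => y (t + r)%N) s = fdiffn k y (t + s)%N.
Proof. by elim: k s => // k IH s; rewrite !fdiffnS !IH addnS. Qed.

(** The root is constant in [s], so it comes out of the difference, and it is the same for every
    [k]. *)
Lemma fdiffn_loss_gap th k c :
  let x := strategy_seq (sc_table th) (sc_step th) (u th) 0 in
  fdiffn k (loss_gap (sc_table th) (sc_step th) i) ((u th).+1 + k)%N (enum_val c) =
  Num.sqrt (x i (pair c).1 * x i (pair c).2) * (sc_step th ^+ k * gap_quotient k th 0 c).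
Proof.
move=> x; rewrite fdiffn_ffun -fdiffn_addl mxE.
rewrite [sc_step th ^+ k * _]mulrC divfK; last first.
  by rewrite expf_neq0 // gt_eqF // sc_step_gt0.
rewrite -(fdiffn_morph (h := *%R _)); last exact: mulrBr.
congr (fdiffn k _ k); apply: funext => s.
by rewrite loss_gapE.
Qed.

End Scenarios.

(** * Conclusion for the loss gaps *)

Lemma norm2_le_sum (R : realType) (I : finType) (v : {ffun I -> R^o}) :
  norm2 v <= \sum_p `|v p : R|.
Proof.
have s0 : 0 <= \sum_p `|v p : R| by exact: sumr_ge0.
rewrite /norm2 -[leRHS](ger0_norm s0) -sqrtr_sqr ler_wsqrtr //.
rewrite [leRHS]expr2 mulr_suml; apply: ler_sum => p _.
rewrite -real_normK ?num_real // expr2 ler_wpM2l //.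
by rewrite (bigD1 p) //= lerDl sumr_ge0.
Qed.

Lemma bounded_noetherian_pullback (R : realType) (P : comNzRingType)
    (C : {rmorphism R -> P}) (T T' : Type) (ev : T -> P -> R) (f : T' -> T) :
  bounded_noetherian C ev -> bounded_noetherian C (fun s => ev (f s)).
Proof.
move=> bn D J L sL; have [nu [[n0 nD nM nC nev] div]] := bn D J L sL.
by exists nu; split=> //; split.
Qed.

Theorem lemma5p8 (R : realType) (n : nat) (hn : (1 <= n)%N)
    (d : 'I_n -> nat) (hd : forall j : 'I_n, (1 <= d j)%N) (i : 'I_n) :
  exists (m : nat) (A M eta_i : R),
    [/\ (1 <= m)%N, 0 < eta_i &
      forall ell : loss_table R d, unit_valued ell ->
      forall eta : R, 0 < eta -> eta <= eta_i ->
      forall t : nat, (1 <= t)%N ->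
      exists c : 'I_m -> R,
        [/\ fdiffn m (loss_gap ell eta i) (t + m)%N =
              \sum_(k < m) (c k * eta ^+ (m - k)%N)
                             *: fdiffn k (loss_gap ell eta i) (t + k)%N,
            forall k : 'I_m, `|c k| <= A &
            forall k : nat, (k <= m)%N ->
              norm2 (fdiffn k (loss_gap ell eta i) (t + k)%N)
                <= M * eta ^+ k]].
Proof.
pose V := (action_profile d * 'I_n + ({j & 'I_(d j)} + {j & 'I_(d j)}))%type : finType.
pose B : R := 1 + #|{: action_profile d}|%:R.
have B0 : 0 < B by rewrite ltr_pwDl.
(* Losses are divided by [B] to put every variable in the unit cube; [Xg] multiplies by [B]
   again. *)
pose coord (th : scenario R d) (v : V) : R := match v with
  | inl (p, j) => sc_table th p j
  | inr (inl x) => strategy_seq (sc_table th) (sc_step th) (sc_time th) 0 (tagged x)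
  | inr (inr x) => loss_seq (sc_table th) (sc_step th) (sc_time th) 0 (tagged x) / B
  end.
have coord1 th v : `|coord th v| <= 1.
  case: v => [[p j]|[x|x]] /=.
  - by have /andP[p0 p1] := sc_unit th p j; rewrite ger0_norm.
  - exact: mixed_le1 (oh_state_mixed hd _ _ _).
  - rewrite normrM normfV (gtr0_norm B0) ler_pdivrMr // mul1r.
    apply: le_trans (oh_loss_bound hd _ (@sc_unit _ _ _ th) _ _) _.
    by rewrite lerDr.
have [P [C [X [ev0 [evX evC bn0]]]]] := exists_polynomial_ring R #|V|.
pose point th (k : 'I_#|V|) := coord th (enum_val k).
have point1 th k : `|point th k| <= 1 by exact: coord1.
pose ev th := ev0 (point th).
pose var (v : V) := X (enum_rank v).
have evvar th v : ev th (var v) = coord th v by rewrite /ev evX /point enum_rankK.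
have bn : bounded_noetherian C (fun th => ev th).
  exact: (bounded_noetherian_pullback (fun th =>
    exist (fun s : 'I_#|V| -> R => forall k, `|s k| <= 1) (point th) (point1 th)) bn0).
pose XL p j := var (inl (p, j)).
pose Xx j (a : 'I_(d j)) := var (inr (inl (Tagged (fun j => 'I_(d j)) a))).
pose Xg j (a : 'I_(d j)) := C B * var (inr (inr (Tagged (fun j => 'I_(d j)) a))).
have ev_loss th j (a : 'I_(d j)) :
    ev th (Xg j a) = loss_seq (sc_table th) (sc_step th) (sc_time th) 0 a.
  by rewrite rmorphM evC evvar /= mulrC divfK // gt_eqF.
have rep := represents_gap_quotient (i := i) hd (fun th => evC (point th))
  (fun th p j => evvar th (inl (p, j)))
  (fun th j a => evvar th (inr (inl (Tagged (fun j => 'I_(d j)) a)))) ev_loss.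
have [m [A [eta0 [m1 eta0p rec]]]] := finite_recurrence (@sc_step_gt0 R n d) bn rep.
(* An empty family of modules still provides an admissible norm, which is all that the bounds on the
   differences require. *)
have [|nu [adm _]] := bn 0%N 'I_0 (fun=> fun=> True); first by case.
have /choice[y Hy] (x : 'I_m.+1 * 'I_#|{: action_pair (d i)}|) : exists y : R * R,
    represents_with ev (@sc_step R n d) nu y.1 y.2
      (fun t => gap_coef C XL Xx Xg i x.1 t 0 x.2) (fun th => gap_quotient i x.1 th 0 x.2).
  by have [K [Q H]] := rep nu adm x.1 x.2; exists (K, Q).
have Qy x : 0 <= (y x).2 by have [_ Q1 _ _] := Hy x; exact: le_trans Q1.
have Ky x : 0 <= (y x).1 by have [K1 _ _ _] := Hy x; exact: le_trans K1.
pose Q := 1 + \sum_x (y x).2.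
have Q1 : 1 <= Q by rewrite lerDl sumr_ge0.
have Qp : 0 < Q by exact: lt_le_trans Q1.
(* [M] adds up the bounds on the quotients for all orders up to [m] and all pairs; [eta <= Q^-1]
   puts [eta] in the range where each of them holds. *)
exists m, A, (\sum_x (y x).1), (Num.min eta0 Q^-1); split=> //.
  by rewrite lt_min eta0p invr_gt0.
move=> ell ell01 eta etap; rewrite le_min => /andP[le0 leQ] t t1.
pose th := Scenario t.-1 ell01 etap.
pose x := strategy_seq ell eta t.-1 0.
pose rho (p : action_pair (d i)) := Num.sqrt (x i (val p).1 * x i (val p).2).
have gapE k c : fdiffn k (loss_gap ell eta i) (t + k)%N (enum_val c) =
    rho (enum_val c) * (eta ^+ k * gap_quotient i k th 0 c).
  by rewrite -{1}(prednK t1); exact: (fdiffn_loss_gap hd th k c).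
have [c [cA recE]] := rec th le0.
exists c; split=> //.
  apply/ffunP => p; rewrite -[p]enum_rankK gapE recE sum_ffunE summxE.
  rewrite mulr_sumr mulr_sumr; apply: eq_bigr => k _.
  rewrite !ffunE gapE mxE /GRing.scale /=.
  (* Each difference of order [k] carries [eta ^ k], so a relation between quotients becomes one
     between differences with the factor [eta ^ (m - k)]. *)
  have -> : eta ^+ m = eta ^+ (m - k) * eta ^+ k by rewrite -exprD subnK // ltnW.
  ring.
move=> k lek; apply: le_trans (norm2_le_sum _) _.
rewrite (reindex _ (onW_bij _ (enum_val_bij _))) /=.
apply: (@le_trans _ _ (\sum_(c < #|{: action_pair (d i)}|)
    (y (inord k, c)).1 * eta ^+ k)).
  apply: ler_sum => j _; rewrite gapE.
  have gK : `|gap_quotient i k th 0 j| <= (y (inord k, j)).1.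
    have := Hy (inord k, j); rewrite /= inordK // => rb; apply: (represents_bound (s := th) rb).
    rewrite /=; apply: le_trans (_ : Q * eta <= 1).
      rewrite ler_wpM2r ?(ltW etap) // /Q (bigD1 (inord k, j)) //= addrCA lerDl.
      by rewrite addr_ge0 ?sumr_ge0.
    by rewrite mulrC -ler_pdivlMr ?div1r.
  have x0 a : 0 <= x i a <= 1.
    rewrite ltW ?(strategy_seq_gt0 hd) //=; apply: le_trans (ler_norm _) _.
    exact: mixed_le1 (oh_state_mixed hd _ _ _).
  have r1 : `|rho (enum_val j)| <= 1.
    rewrite ger0_norm ?sqrtr_ge0 // -sqrtr1 ler_wsqrtr //.
    by have /andP[? ?] := x0 (val (enum_val j)).1;
       have /andP[? ?] := x0 (val (enum_val j)).2; rewrite mulr_ile1.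
  rewrite normrM -[leRHS]mul1r ler_pM // normrM mulrC.
  by rewrite [`|eta ^+ k|]ger0_norm ?ler_wpM2r ?exprn_ge0 ?(ltW etap).
rewrite -mulr_suml ler_wpM2r ?exprn_ge0 ?(ltW etap) //.
have -> : \sum_x (y x).1 = \sum_a \sum_b (y (a, b)).1.
  by rewrite pair_bigA; apply: eq_bigr => -[].
rewrite [leRHS](bigD1 (inord k)) //= lerDl.
by apply: sumr_ge0 => a _; apply: sumr_ge0.
Qed.
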